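(* Let $\Gamma$ be a countable group and $N\le\Gamma$ an amenable normal subgroup. Then the pullback map $\operatorname{H}_a^n(\Gamma/N,\mathcal{V})\to\operatorname{H}_a^n(\Gamma,\mathcal{V})$ is an isomorphism, for all $n\ge 0$ and all dual asymptotic Banach ${}^{*}(\Gamma/N)$-modules $\mathcal{V}$.
   Context: All groups are discrete and countable. **Asymptotic modules.** Fix a non-principal ultrafilter $\omega$ on $\mathbb{N}$. For sets $X_n$, $\prod_\omega X_n$ is the algebraic ultraproduct (sequences modulo equality on a set in $\omega$). ${}^{*}G=\prod_\omega G$ for a group $G$, ${}^{*}\mathbb{R}=\prod_\omega\mathbb{R}$, ${}^{*}\mathbb{R}_b$ is the set of bounded hyperreals and ${}^{*}\mathbb{R}_{inf}$ the set of infinitesimals. A map between ultraproducts is *internal* if it is induced by a sequence of maps. For Banach spaces $V_n$ let $\mathcal{V}=\prod_\omega V_n$ with ${}^{*}\mathbb{R}$-valued norm $\|\{v_n\}_\omega\|=\{\|v_n\|\}_\omega$, $\mathcal{V}_b=\{v:\|v\|\in{}^{*}\mathbb{R}_b\}$, $\mathcal{V}_{inf}=\{v:\|v\|\in{}^{*}\mathbb{R}_{inf}\}$ and $\widetilde{\mathcal{V}}=\mathcal{V}_b/\mathcal{V}_{inf}$, a real Banach space. An *asymptotic Banach ${}^{*}G$-module* is such a $\mathcal{V}$ together with an internal map $\pi=\{\pi_n\}_\omega:{}^{*}G\times\mathcal{V}\to\mathcal{V}$, where each $\pi_n(g):V_n\to V_n$ is linear and norm-preserving, which induces an isometric linear action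 $\tilde\pi$ of ${}^{*}G$ on $\widetilde{\mathcal{V}}$. The internal dual is $\mathcal{V}^\#=\prod_\omega V_n^\#$ ($V_n^\#$ the continuous dual), with the contragredient $\pi^\#$ defined coordinatewise by $(\pi_n^\#(g)\lambda)(v)=\lambda(\pi_n(g^{-1})v)$. $\mathcal{V}$ is a *dual* asymptotic Banach ${}^{*}G$-module if it is the internal dual, with contragredient action, of some asymptotic Banach ${}^{*}G$-module $\mathcal{V}^\flat$. **Asymptotic cohomology.** For $m\ge1$ let $\mathcal{L}^\infty(({}^{*}G)^m,\mathcal{V})=\prod_\omega\ell^\infty(G^m,V_n)$, with bounded and infinitesimal parts (for the sup norms) $\mathcal{L}^\infty_b$, $\mathcal{L}^\infty_{inf}$ and quotient $\widetilde{\mathcal{L}}^\infty(({}^{*}G)^m,\mathcal{V})=\mathcal{L}^\infty_b/\mathcal{L}^\infty_{inf}$. ${}^{*}G$ acts on this quotient via $(g\cdot f)(g_1,\dots,g_m)=\pi(g)f(g^{-1}g_1,\dots,g^{-1}g_m)$; invariants are denoted by the superscript ${}^{*}G$. Define $d^m:\mathcal{L}^\infty(({}^{*}G)^m,\mathcal{V})\to\mathcal{L}^\infty(({}^{*}G)^{m+1},\mathcal{V})$ by $d^m f(g_0,\dots,g_m)=\sum_{j=0}^m(-1)^jf(g_0,\dots,\widehat{g_j},\dots,g_m)$. It induces maps $\tilde d^m$ giving the complex $0\xrightarrow{\tilde d^0}\widetilde{\mathcal{L}}^\infty({}^{*}G,\mathcal{V})^{{}^{*}G}\xrightarrow{\tilde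 d^1}\widetilde{\mathcal{L}}^\infty(({}^{*}G)^2,\mathcal{V})^{{}^{*}G}\xrightarrow{\tilde d^2}\cdots$, and $\operatorname{H}_a^m(G,\mathcal{V})=\ker(\tilde d^{m+1})/\operatorname{im}(\tilde d^m)$ for $m\ge0$. **Pullback map.** A dual asymptotic Banach ${}^{*}(\Gamma/N)$-module becomes a dual asymptotic Banach ${}^{*}\Gamma$-module via the projection ${}^{*}\Gamma\to{}^{*}(\Gamma/N)$. Precomposing cochains with this projection induces the *pullback map* $\operatorname{H}_a^\bullet(\Gamma/N,\mathcal{V})\to\operatorname{H}_a^\bullet(\Gamma,\mathcal{V})$. *)

(* Defs.v *)
From HB Require Import structures.
From mathcomp Require Import all_boot all_order all_algebra.
From mathcomp Require Import boolp classical_sets functions cardinality filter.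
From mathcomp Require Import reals topology normedtype.

Set Implicit Arguments.
Unset Strict Implicit.
Unset Printing Implicit Defensive.

Import Order.TTheory GRing.Theory Num.Theory.
Import numFieldNormedType.Exports.

Local Open Scope classical_set_scope.
Local Open Scope quotient_scope.
Local Open Scope ring_scope.

(** * Subquotients [Z / B] of a module; [B] need only be given on the ambient
    module: the quotient is by [Z :&: B]. *)

Lemma submN (R : pzRingType) (M : lmodType R) (Z : submodClosed M) (x : M) :
  (- x \in (Z : {pred M})) = (x \in (Z : {pred M})).
Proof.
by apply/idP/idP => /(rpredZ (-1)); rewrite scaleN1r ?opprK.
Qed.

Section Subquotient.
Context {R : nzRingType} {M : lmodType R}.

Record subm (Z : submodClosed M) :=
  Subm { subm_val :> M; subm_valP : subm_val \in (Z : {pred M}) }.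

HB.instance Definition _ Z := [isSub for @subm_val Z].
HB.instance Definition _ Z := [Choice of subm Z by <:].
HB.instance Definition _ (Z : submodClosed M) :=
  [SubChoice_isSubLmodule of subm Z by <:].

Lemma subm_valD Z (x y : subm Z) : \val (x + y) = \val x + \val y.
Proof. by []. Qed.
Lemma subm_valN Z (x : subm Z) : \val (- x) = - \val x.
Proof. exact: raddfN. Qed.
Lemma subm_valZ Z a (x : subm Z) : \val (a *: x) = a *: \val x.
Proof. exact: linearZ. Qed.

Context (Z B : submodClosed M).

Definition sqrel (x y : subm Z) : bool := \val x - \val y \in (B : {pred M}).

Lemma sqrel_equiv : equiv_class_of sqrel.
Proof.
split=> [x|x y|y x z]; rewrite /sqrel ?subrr ?rpred0//.
  by rewrite -opprB submN.
by move=> xy yz; rewrite -(subrKA (\val y)) rpredD.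
Qed.

Canonical sqrel_equiv_rel := EquivRelPack sqrel_equiv.

Definition subquot := {eq_quot sqrel}.
HB.instance Definition _ := EqQuotient.on subquot.
HB.instance Definition _ := Choice.on subquot.

Definition sqpi (x : subm Z) : subquot := \pi x.
Lemma sqpi_surj (q : subquot) : exists x, q = sqpi x.
Proof. by exists (repr q); rewrite /sqpi reprK. Qed.

Lemma sqpi_eq x y : (sqpi x = sqpi y) <-> (\val x - \val y \in (B : {pred M})).
Proof.
split; first by move/eqP; rewrite /sqpi eqmodE.
by move=> h; apply/eqP; rewrite /sqpi eqmodE.
Qed.

Definition sqadd (p q : subquot) : subquot := sqpi (repr p + repr q).
Definition sqopp (p : subquot) : subquot := sqpi (- repr p).
Definition sqscale (a : R) (p : subquot) : subquot := sqpi (a *: repr p).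

Lemma repr_sqpi x : \val (repr (sqpi x)) - \val x \in (B : {pred M}).
Proof. by apply/sqpi_eq; rewrite /sqpi reprK. Qed.

Lemma sqaddE x y : sqadd (sqpi x) (sqpi y) = sqpi (x + y).
Proof.
apply/sqpi_eq; rewrite !subm_valD opprD addrACA.
by rewrite rpredD ?repr_sqpi.
Qed.
Lemma sqoppE x : sqopp (sqpi x) = sqpi (- x).
Proof. by apply/sqpi_eq; rewrite !subm_valN -opprD submN repr_sqpi. Qed.
Lemma sqscaleE a x : sqscale a (sqpi x) = sqpi (a *: x).
Proof. by apply/sqpi_eq; rewrite !subm_valZ -scalerBr rpredZ ?repr_sqpi. Qed.

Fact sqaddA : associative sqadd.
Proof.
move=> p q r; have [x ->] := sqpi_surj p; have [y ->] := sqpi_surj q.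
by have [z ->] := sqpi_surj r; rewrite !sqaddE addrA.
Qed.
Fact sqaddC : commutative sqadd.
Proof.
move=> p q; have [x ->] := sqpi_surj p; have [y ->] := sqpi_surj q.
by rewrite !sqaddE addrC.
Qed.
Fact sqadd0 : left_id (sqpi 0) sqadd.
Proof. by move=> p; have [x ->] := sqpi_surj p; rewrite sqaddE add0r. Qed.
Fact sqaddN : left_inverse (sqpi 0) sqopp sqadd.
Proof.
by move=> p; have [x ->] := sqpi_surj p; rewrite sqoppE sqaddE addNr.
Qed.
HB.instance Definition _ :=
  GRing.isZmodule.Build subquot sqaddA sqaddC sqadd0 sqaddN.

Fact sqscaleA a b p : sqscale a (sqscale b p) = sqscale (a * b) p.
Proof. by have [x ->] := sqpi_surj p; rewrite !sqscaleE scalerA. Qed.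
Fact sqscale1 : left_id 1 sqscale.
Proof. by move=> p; have [x ->] := sqpi_surj p; rewrite !sqscaleE scale1r. Qed.
Fact sqscaleDr : right_distributive sqscale +%R.
Proof.
move=> a p q; have [x ->] := sqpi_surj p; have [y ->] := sqpi_surj q.
by rewrite [_ + _]sqaddE !sqscaleE [RHS]sqaddE scalerDr.
Qed.
Fact sqscaleDl p : {morph sqscale^~ p : a b / a + b}.
Proof.
move=> a b; have [x ->] := sqpi_surj p.
by rewrite !sqscaleE [RHS]sqaddE scalerDl.
Qed.
HB.instance Definition _ := GRing.Zmodule_isLmodule.Build R subquot
  sqscaleA sqscale1 sqscaleDr sqscaleDl.

Fact sqpi_linear : linear sqpi.
Proof. by move=> a x y; rewrite [a *: sqpi x]sqscaleE [RHS]sqaddE. Qed.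
HB.instance Definition _ :=
  GRing.isLinear.Build R (subm Z) subquot _ sqpi sqpi_linear.

End Subquotient.

Section SubquotientMap.
Context {R : nzRingType} {M M' : lmodType R}.
Context {Z B : submodClosed M} {Z' B' : submodClosed M'}.
Context (f : {linear M -> M'}).
Context (fZ : forall x, x \in (Z : {pred M}) -> f x \in (Z' : {pred M'})).
Context (fB : forall x, x \in (Z : {pred M}) -> x \in (B : {pred M}) ->
  f x \in (B' : {pred M'})).

Definition submap (x : subm Z) : subm Z' := Subm (fZ (subm_valP x)).

#[using="fZ fB"]
Definition sqmap (p : subquot Z B) : subquot Z' B' := sqpi B' (submap (repr p)).

Lemma sqmapE x : sqmap (sqpi B x) = sqpi B' (submap x).
Proof.
apply/sqpi_eq => /=; rewrite -linearB fB ?repr_sqpi//.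
by rewrite rpredD ?submN ?subm_valP.
Qed.

Fact sqmap_linear : linear sqmap.
Proof.
move=> a p q; have [x ->] := sqpi_surj p; have [y ->] := sqpi_surj q.
rewrite -linearP !sqmapE -linearP; congr sqpi.
by apply: val_inj; rewrite /= linearP.
Qed.
HB.instance Definition _ :=
  GRing.isLinear.Build R (subquot Z B) (subquot Z' B') _ sqmap sqmap_linear.

End SubquotientMap.

(** * Ultraproducts *)

Record freeUltrafilter := FreeUltrafilter {
  ultra_sets :> set nat -> Prop ;
  ultra_ultra : UltraFilter ultra_sets ;
  ultra_free : forall n, ~ ultra_sets [set n] }.

#[global] Instance freeUltrafilter_ultra (w : freeUltrafilter) :
  UltraFilter (ultra_sets w) := ultra_ultra w.

Definition dseq (X : nat -> Type) := forall n, X n.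
HB.instance Definition _ X := gen_eqMixin (dseq X).
HB.instance Definition _ X := gen_choiceMixin (dseq X).

Section Ultraproduct.
Context (w : freeUltrafilter).

(** Sequences are identified when they agree on a set of [w]. *)
Definition ueq (X : nat -> Type) (x y : dseq X) : bool :=
  `[< w [set n | x n = y n] >].

Lemma ueq_equiv X : equiv_class_of (@ueq X).
Proof.
split=> [x|x y|y x z].
- by apply/asboolP; apply: filterS filterT => n.
- by apply/asboolP/asboolP; apply: filterS => n /=.
- move=> /asboolP xy /asboolP yz; apply/asboolP.
  by apply: filterS2 xy yz => n /= -> ->.
Qed.

Canonical ueq_equiv_rel X := EquivRelPack (@ueq_equiv X).

Definition uprod (X : nat -> Type) := {eq_quot (@ueq X)}.
HB.instance Definition _ X := EqQuotient.on (uprod X).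
HB.instance Definition _ X := Choice.on (uprod X).

Definition ucls X (x : dseq X) : uprod X := \pi x.

Lemma ucls_surj X (p : uprod X) : exists x, p = ucls x.
Proof. by exists (repr p); rewrite /ucls reprK. Qed.

Lemma ucls_eq X (x y : dseq X) :
  (ucls x = ucls y) <-> w [set n | x n = y n].
Proof.
split; first by move/eqP; rewrite /ucls eqmodE => /asboolP.
by move=> h; apply/eqP; rewrite /ucls eqmodE; apply/asboolP.
Qed.

Lemma repr_ucls X (x : dseq X) : w [set n | repr (ucls x) n = x n].
Proof. by apply/ucls_eq; rewrite /ucls reprK. Qed.

(** Internal maps, and internal (binary) operations. *)
Definition umap X Y (F : forall n, X n -> Y n) (p : uprod X) : uprod Y :=
  ucls (fun n => F n (repr p n)).

Definition umap2 X Y Z (F : forall n, X n -> Y n -> Z n)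
    (p : uprod X) (q : uprod Y) : uprod Z :=
  ucls (fun n => F n (repr p n) (repr q n)).

Lemma umapE X Y (F : forall n, X n -> Y n) x :
  umap F (ucls x) = ucls (fun n => F n (x n)).
Proof. by apply/ucls_eq; apply: filterS (repr_ucls x) => n /= ->. Qed.

Lemma umap2E X Y Z (F : forall n, X n -> Y n -> Z n) x y :
  umap2 F (ucls x) (ucls y) = ucls (fun n => F n (x n) (y n)).
Proof.
apply/ucls_eq; apply: filterS2 (repr_ucls x) (repr_ucls y).
by move=> n /= -> ->.
Qed.

(** The ultrapower [*G] of a group. *)
Section Ultrapower.
Context (G : groupType).

Definition upow := uprod (fun=> G).
HB.instance Definition _ := Choice.on upow.

Definition upow1 : upow := ucls (fun=> 1%g).
Definition upowV : upow -> upow := umap (fun _ (g : G) => g^-1%g).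
Definition upowM : upow -> upow -> upow := umap2 (fun _ (g h : G) => (g * h)%g).

Fact upowMA : associative upowM.
Proof.
move=> p q r; have [x ->] := ucls_surj p; have [y ->] := ucls_surj q.
have [z ->] := ucls_surj r; rewrite /upowM.
rewrite (umap2E _ x y) (umap2E _ y z) [LHS]umap2E [RHS]umap2E.
by congr ucls; apply: functional_extensionality_dep => n; rewrite mulgA.
Qed.
Fact upowM1l : left_id upow1 upowM.
Proof.
move=> p; have [x ->] := ucls_surj p; rewrite /upowM umap2E; congr ucls.
by apply: functional_extensionality_dep => n; rewrite mul1g.
Qed.
Fact upowM1r : right_id upow1 upowM.
Proof.
move=> p; have [x ->] := ucls_surj p; rewrite /upowM umap2E; congr ucls.
by apply: functional_extensionality_dep => n; rewrite mulg1.
Qed.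
Fact upowMVl : left_inverse upow1 upowV upowM.
Proof.
move=> p; have [x ->] := ucls_surj p.
rewrite /upowM /upowV umapE umap2E; congr ucls.
by apply: functional_extensionality_dep => n; rewrite mulVg.
Qed.
Fact upowMVr : right_inverse upow1 upowV upowM.
Proof.
move=> p; have [x ->] := ucls_surj p.
rewrite /upowM /upowV umapE umap2E; congr ucls.
by apply: functional_extensionality_dep => n; rewrite mulgV.
Qed.
HB.instance Definition _ :=
  isGroup.Build upow upowMA upowM1l upowM1r upowMVl upowMVr.

End Ultrapower.

(** Ultraproducts of normed spaces *)
Section Module.
Context {R : realType}.
Implicit Types V W : nat -> normedModType R.

Definition umod V := uprod (fun n => V n).
HB.instance Definition _ V := Choice.on (umod V).

Section UltraModule.
Context V.
Let Vs (n : nat) : Type := V n.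

Definition umod0 : umod V := @ucls Vs (fun=> 0).
Definition umodN : umod V -> umod V := @umap Vs Vs (fun _ v => - v).
Definition umodD : umod V -> umod V -> umod V :=
  @umap2 Vs Vs Vs (fun _ u v => u + v).
Definition umodZ (a : R) : umod V -> umod V := @umap Vs Vs (fun _ v => a *: v).

Fact umodDA : associative umodD.
Proof.
move=> p q r; have [x ->] := ucls_surj p; have [y ->] := ucls_surj q.
have [z ->] := ucls_surj r; rewrite /umodD.
rewrite (umap2E _ x y) (umap2E _ y z) [LHS]umap2E [RHS]umap2E.
by congr ucls; apply: functional_extensionality_dep => n; rewrite addrA.
Qed.
Fact umodDC : commutative umodD.
Proof.
move=> p q; have [x ->] := ucls_surj p; have [y ->] := ucls_surj q.
rewrite /umodD !umap2E; congr ucls.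
by apply: functional_extensionality_dep => n; rewrite addrC.
Qed.
Fact umodD0 : left_id umod0 umodD.
Proof.
move=> p; have [x ->] := ucls_surj p; rewrite /umodD umap2E; congr ucls.
by apply: functional_extensionality_dep => n; rewrite add0r.
Qed.
Fact umodDN : left_inverse umod0 umodN umodD.
Proof.
move=> p; have [x ->] := ucls_surj p.
rewrite /umodD /umodN umapE umap2E; congr ucls.
by apply: functional_extensionality_dep => n; rewrite addNr.
Qed.
HB.instance Definition _ :=
  GRing.isZmodule.Build (umod V) umodDA umodDC umodD0 umodDN.

Fact umodZA a b p : umodZ a (umodZ b p) = umodZ (a * b) p.
Proof.
have [x ->] := ucls_surj p; rewrite /umodZ !(umapE _ x) [LHS]umapE.
by congr ucls; apply: functional_extensionality_dep => n; rewrite scalerA.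
Qed.
Fact umodZ1 : left_id 1 umodZ.
Proof.
move=> p; have [x ->] := ucls_surj p; rewrite /umodZ umapE; congr ucls.
by apply: functional_extensionality_dep => n; rewrite scale1r.
Qed.
Fact umodZDr : right_distributive umodZ +%R.
Proof.
move=> a p q; have [x ->] := ucls_surj p; have [y ->] := ucls_surj q.
rewrite [_ + _]umap2E /umodZ (umapE _ x) (umapE _ y) [LHS]umapE [RHS]umap2E.
congr ucls.
by apply: functional_extensionality_dep => n; rewrite scalerDr.
Qed.
Fact umodZDl p : {morph umodZ^~ p : a b / a + b}.
Proof.
move=> a b; have [x ->] := ucls_surj p.
rewrite /umodZ !(umapE _ x) [RHS]umap2E; congr ucls.
by apply: functional_extensionality_dep => n; rewrite scalerDl.
Qed.
HB.instance Definition _ := GRing.Zmodule_isLmodule.Build R (umod V)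
  umodZA umodZ1 umodZDr umodZDl.

Definition uvec (v : dseq (fun n => V n)) : umod V := ucls v.

Lemma uvecD u v : uvec u + uvec v = uvec (fun n => u n + v n).
Proof. exact: umap2E. Qed.
Lemma uvecN u : - uvec u = uvec (fun n => - u n).
Proof. exact: umapE. Qed.
Lemma uvecB u v : uvec u - uvec v = uvec (fun n => u n - v n).
Proof. by rewrite uvecN uvecD. Qed.
Lemma uvecZ a u : a *: uvec u = uvec (fun n => a *: u n).
Proof. exact: umapE. Qed.

Definition unorm : umod V -> uprod (fun=> R) :=
  @umap Vs (fun=> R) (fun _ v => `|v|).

End UltraModule.

(** The standard real [a] is viewed as a constant hyperreal. *)
Definition hyper_le (x : uprod (fun=> R)) (a : R) : Prop :=
  w [set n | repr x n <= a].

Definition hyper_bounded (x : uprod (fun=> R)) : Prop :=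
  exists M : R, hyper_le (@umap (fun=> R) (fun=> R) (fun _ r => `|r|) x) M.

Definition hyper_infinitesimal (x : uprod (fun=> R)) : Prop :=
  forall e : R, 0 < e ->
  hyper_le (@umap (fun=> R) (fun=> R) (fun _ r => `|r|) x) e.

Definition bddpart V : {pred umod V} := fun v => `[< hyper_bounded (unorm v) >].

Definition infpart V : {pred umod V} :=
  fun v => `[< hyper_infinitesimal (unorm v) >].

Lemma hyper_leE (x : dseq (fun=> R)) a :
  hyper_le (ucls x) a <-> w [set n | x n <= a].
Proof.
by split; apply: filterS2 (repr_ucls x) => n /= ->.
Qed.

Lemma unorm_le V (v : dseq (fun n => V n)) (a : R) :
  hyper_le (@umap (fun=> R) (fun=> R) (fun _ r => `|r|) (unorm (uvec v))) a <->
  w [set n | `|v n| <= a].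
Proof.
rewrite /unorm (umapE _ v) [X in hyper_le X](umapE _ (fun n => `|v n|)).
by split => [/hyper_leE|h]; last apply/hyper_leE; under eq_fun do
  rewrite normr_id.
Qed.

Lemma bddpartE V (v : dseq (fun n => V n)) :
  reflect (exists M : R, w [set n | `|v n| <= M]) (uvec v \in @bddpart V).
Proof. by apply: (iffP (asboolP _)) => -[M /unorm_le]; exists M. Qed.

Lemma infpartE V (v : dseq (fun n => V n)) :
  reflect (forall e : R, 0 < e -> w [set n | `|v n| <= e])
    (uvec v \in @infpart V).
Proof. by apply: (iffP (asboolP _)) => h e e0; apply/unorm_le/h. Qed.

Fact bddpart_submod V : submod_closed (@bddpart V).
Proof.
split.
  by apply/bddpartE; exists 0; apply: filterS filterT => n _ /=; rewrite normr0.
move=> a p q; have [x ->] := ucls_surj p; have [y ->] := ucls_surj q.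
move=> /bddpartE[M hM] /bddpartE[M' hM'].
rewrite -[ucls x]/(uvec x) -[ucls y]/(uvec y) uvecZ uvecD.
apply/bddpartE; exists (`|a| * M + M'); apply: filterS2 hM hM' => n /= h h'.
by rewrite (le_trans (ler_normD _ _))// normrZ lerD// ler_wpM2l.
Qed.
HB.instance Definition _ V :=
  GRing.isSubmodClosed.Build R (umod V) (@bddpart V) (bddpart_submod V).

Fact infpart_submod V : submod_closed (@infpart V).
Proof.
split.
  apply/infpartE => e e0; apply: filterS filterT => n _ /=.
  by rewrite normr0 ltW.
move=> a p q; have [x ->] := ucls_surj p; have [y ->] := ucls_surj q.
move=> /infpartE hx /infpartE hy.
rewrite -[ucls x]/(uvec x) -[ucls y]/(uvec y) uvecZ uvecD.
apply/infpartE => e e0.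
have a1 : 0 < `|a| + 1 by rewrite ltr_wpDl.
have e2 : 0 < e / 2 by rewrite divr_gt0.
apply: filterS2 (hx (e / 2 / (`|a| + 1)) _) (hy (e / 2) e2).
  move=> n /= h h'; rewrite (le_trans (ler_normD _ _))// normrZ.
  rewrite [leRHS](splitr e) lerD//.
  rewrite (le_trans (ler_wpM2l _ h))// mulrA ler_pdivrMr// mulrC.
  by rewrite ler_pM2l// lerDl.
by rewrite divr_gt0.
Qed.
HB.instance Definition _ V :=
  GRing.isSubmodClosed.Build R (umod V) (@infpart V) (infpart_submod V).

(** [V_b / V_inf] *)
Definition utilde V := subquot (@bddpart V) (@infpart V).
HB.instance Definition _ V := GRing.Lmodule.on (utilde V).

End Module.
End Ultraproduct.

(** * Internal operators given by uniformly bounded sequences *)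

Section BoundedOperators.
Context {R : realType}.
Implicit Types V W : nat -> normedModType R.

Record bop V W := Bop {
  bop_fun :> forall n, {linear V n -> W n} ;
  bop_bound : exists C : R, forall n v, `|bop_fun n v| <= C * `|v| }.

Context (w : freeUltrafilter).

Section Induced.
Context {V W} (F : bop V W).

Definition umor : umod w V -> umod w W :=
  @umap w (fun n => V n) (fun n => W n) (fun n => F n).

Lemma umorE (v : dseq (fun n => V n)) :
  umor (uvec w v) = uvec w (fun n => F n (v n)).
Proof. exact: umapE. Qed.

Fact umor_linear : linear umor.
Proof.
move=> a p q; have [x ->] := ucls_surj p; have [y ->] := ucls_surj q.
rewrite -[ucls w x]/(uvec w x) -[ucls w y]/(uvec w y).
rewrite uvecZ uvecD !umorE uvecZ uvecD; congr uvec.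
by apply: functional_extensionality_dep => n; rewrite linearP.
Qed.
HB.instance Definition _ :=
  GRing.isLinear.Build R (umod w V) (umod w W) _ umor umor_linear.

Lemma umor_bdd p : p \in @bddpart w R V -> umor p \in @bddpart w R W.
Proof.
have [x ->] := ucls_surj p => /bddpartE[M hM]; rewrite umorE.
have [C hC] := bop_bound F; apply/bddpartE; exists (`|C| * M).
apply: filterS hM => n /= h; rewrite (le_trans (hC _ _))//.
by rewrite (le_trans (ler_wpM2r _ (ler_norm C)))// ler_wpM2l.
Qed.

Lemma umor_inf p : p \in @infpart w R V -> umor p \in @infpart w R W.
Proof.
have [x ->] := ucls_surj p => /infpartE hx; rewrite umorE.
have [C hC] := bop_bound F; apply/infpartE => e e0.
have C1 : 0 < `|C| + 1 by rewrite ltr_wpDl.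
apply: filterS (hx (e / (`|C| + 1)) (divr_gt0 e0 C1)) => n /= h.
rewrite (le_trans (hC _ _))// (le_trans (ler_wpM2r _ (ler_norm C)))//.
rewrite (le_trans (ler_wpM2l _ h))// mulrA ler_pdivrMr// mulrC.
by rewrite ler_pM2l// lerDl.
Qed.

(** The operator induced by [F] from [V_b / V_inf] to [W_b / W_inf]. *)
Definition tmor : {linear utilde w V -> utilde w W} :=
  sqmap umor_bdd (fun p _ => @umor_inf p).

End Induced.

Definition tcls V (v : dseq (fun n => V n))
    (hv : exists M : R, w [set n | `|v n| <= M]) : utilde w V :=
  sqpi (@infpart w R V) (Subm (introT (bddpartE w v) hv)).

Lemma tcls_surj V (p : utilde w V) : exists v hv, p = @tcls V v hv.
Proof.
have [[u hu] ->] := sqpi_surj p; have [v uv] := ucls_surj u.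
have hv : exists M : R, w [set n | `|v n| <= M].
  by apply/(bddpartE w v); rewrite /uvec -uv.
by exists v, hv; congr sqpi; apply: val_inj.
Qed.

Lemma tcls_eq V (u v : dseq (fun n => V n)) hu hv :
  (@tcls V u hu = @tcls V v hv) <->
  (forall e : R, 0 < e -> w [set n | `|u n - v n| <= e]).
Proof.
split=> [/sqpi_eq|h]; last apply/sqpi_eq; rewrite /= uvecB.
  by move/infpartE.
exact/infpartE.
Qed.

Lemma tcls_ae V (u v : dseq (fun n => V n)) hu hv :
  w [set n | u n = v n] -> @tcls V u hu = @tcls V v hv.
Proof.
move=> uv; apply/tcls_eq => e e0.
by apply: filterS uv => n /= ->; rewrite subrr normr0 ltW.
Qed.

Lemma tmorE V W (F : bop V W) v hv : exists hFv,
  tmor F (@tcls V v hv) = @tcls W (fun n => F n (v n)) hFv.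
Proof.
have hFv : exists M : R, w [set n | `|F n (v n)| <= M].
  apply/(bddpartE w (fun n => F n (v n))); rewrite -umorE umor_bdd//.
  exact/bddpartE.
exists hFv; rewrite /tmor/= sqmapE; congr sqpi; apply: val_inj => /=.
exact: umorE.
Qed.

Lemma tmor_comp V W X (F : bop V W) (G : bop W X) (H : bop V X) :
  (forall n v, G n (F n v) = H n v) ->
  forall p, tmor G (tmor F p) = tmor H p.
Proof.
move=> GF p; have [v [hv ->]] := tcls_surj p.
have [h1 ->] := tmorE F hv; have [h2 ->] := tmorE G h1.
have [h3 ->] := tmorE H hv.
by apply: tcls_ae; apply: filterS filterT => n _; exact: GF.
Qed.

End BoundedOperators.

(** * The spaces of bounded functions and the continuous dual *)

Section BoundedFunctions.
Context {R : realType} (X : Type) (V : normedModType R).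

Definition bddfun : {pred X -> V} :=
  fun f => `[< exists M : R, forall x, `|f x| <= M >].

Fact bddfun_submod : submod_closed bddfun.
Proof.
split; first by apply/asboolP; exists 0 => x; rewrite normr0.
move=> a f g /asboolP[M hM] /asboolP[M' hM']; apply/asboolP.
exists (`|a| * M + M') => x; rewrite (le_trans (ler_normD _ _))// normrZ.
by rewrite lerD// ler_wpM2l.
Qed.
HB.instance Definition _ :=
  GRing.isSubmodClosed.Build R (X -> V) bddfun bddfun_submod.

Record linf := Linf { linf_fun :> X -> V ; linf_bdd : linf_fun \in bddfun }.
HB.instance Definition _ := [isSub for linf_fun].
HB.instance Definition _ := [Choice of linf by <:].
HB.instance Definition _ := [SubChoice_isSubLmodule of linf by <:].

Definition linf_norm (f : linf) : R := sup (range (fun x => `|f x|)).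

Lemma linf_norm_ub (f : linf) x : `|f x| <= linf_norm f.
Proof.
apply: ub_le_sup; last by exists x.
by have /asboolP[M hM] := linf_bdd f; exists M => _ [y _ <-].
Qed.

Let linf_norm_out f : ~ ([set: X] !=set0) -> linf_norm f = 0.
Proof.
move=> X0; rewrite /linf_norm; have -> : range (fun x => `|f x|) = set0.
  by rewrite -subset0 => z [y _ _]; apply: X0; exists y.
exact: sup0.
Qed.

Lemma linf_norm_le (f : linf) (M : R) :
  0 <= M -> (forall x, `|f x| <= M) -> linf_norm f <= M.
Proof.
move=> M0 hM; have [[x _]|X0] := pselect ([set: X] !=set0).
  by apply: ge_sup; [exists `|f x|, x|move=> _ [y _ <-]].
by rewrite linf_norm_out.
Qed.

Lemma linf_norm_ge0 f : 0 <= linf_norm f.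
Proof.
have [[x _]|X0] := pselect ([set: X] !=set0).
  exact: le_trans (normr_ge0 _) (linf_norm_ub f x).
by rewrite linf_norm_out.
Qed.

Lemma linfD (f g : linf) x : (f + g) x = f x + g x. Proof. by []. Qed.
Lemma linfN (f : linf) x : (- f) x = - f x. Proof. by []. Qed.
Lemma linfZ a (f : linf) x : (a *: f) x = a *: f x. Proof. by []. Qed.

Fact linf_normD f g : linf_norm (f + g) <= linf_norm f + linf_norm g.
Proof.
apply: linf_norm_le => [|x]; first by rewrite addr_ge0 ?linf_norm_ge0.
by rewrite (le_trans (ler_normD _ _))// lerD ?linf_norm_ub.
Qed.

Let linf_normZle (a : R) f : linf_norm (a *: f) <= `|a| * linf_norm f.
Proof.
apply: linf_norm_le => [|x]; first by rewrite mulr_ge0 ?linf_norm_ge0.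
by rewrite linfZ normrZ ler_wpM2l ?linf_norm_ub.
Qed.

Fact linf_normZ (a : R) f : linf_norm (a *: f) = `|a| * linf_norm f.
Proof.
apply/eqP; rewrite eq_le linf_normZle/=.
have [->|a0] := eqVneq a 0; first by rewrite normr0 mul0r linf_norm_ge0.
rewrite -ler_pdivlMl ?normr_gt0// -normfV.
by rewrite (le_trans _ (linf_normZle _ _))// scalerA mulVf// scale1r.
Qed.

Fact linf_norm_eq0 f : linf_norm f = 0 -> f = 0.
Proof.
move=> f0; apply: val_inj; apply/funext => x /=.
by apply/eqP; rewrite -normr_le0 -f0 linf_norm_ub.
Qed.

HB.instance Definition _ := @Lmodule_isNormed.Build R linf
  linf_norm linf_normD linf_normZ linf_norm_eq0.

Lemma linf_normE (f : linf) : `|f| = sup (range (fun x => `|f x|)).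
Proof. by []. Qed.
Lemma linf_ub (f : linf) x : `|f x| <= `|f|. Proof. exact: linf_norm_ub. Qed.
Lemma linf_le (f : linf) (M : R) :
  0 <= M -> (forall x, `|f x| <= M) -> `|f| <= M.
Proof. exact: linf_norm_le. Qed.

End BoundedFunctions.

Section BoundedFunctionMaps.
Context {R : realType} {X Y : Type} {V W : normedModType R}.

Fact linf_comp_bdd (p : X -> Y) (f : linf Y V) : f \o p \in @bddfun R X V.
Proof. by apply/asboolP; exists `|f| => x; exact: linf_ub. Qed.

Definition linf_comp (p : X -> Y) (f : linf Y V) : linf X V :=
  Linf (linf_comp_bdd p f).

Fact linf_comp_linear p : linear (linf_comp p).
Proof. by move=> a f g; apply: val_inj. Qed.
HB.instance Definition _ p :=
  GRing.isLinear.Build R (linf Y V) (linf X V) _ (linf_comp p)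
    (linf_comp_linear p).

Lemma linf_comp_norm p f : `|linf_comp p f| <= `|f|.
Proof. by apply: linf_le => // x; exact: (linf_ub f (p x)). Qed.

End BoundedFunctionMaps.

Section Dual.
Context {R : realType} (V : normedModType R).

Definition contlin : {pred V -> R^o} :=
  fun f => `[< linear f /\ continuous f >].

Let pack_linear (f : V -> R^o) (lf : linear f) : {linear V -> R^o} :=
  HB.pack f (GRing.isLinear.Build _ _ _ _ _ lf).

Lemma contlinP (f : V -> R^o) : reflect
  (linear f /\ exists C : R, forall x, `|f x| <= C * `|x|) (f \in contlin).
Proof.
apply: (iffP (asboolP _)) => -[lf cf]; split=> //.
  have /linear_boundedP := (linear_bounded_continuous (pack_linear lf)).2 cf.
  by move=> /pinfty_ex_gt0[C _ hC]; exists C.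
apply: (linear_bounded_continuous (pack_linear lf)).1; apply/linear_boundedP.
case: cf => C hC; near=> r => x /=; rewrite (le_trans (hC _))// ler_wpM2r//.
by near: r; apply: nbhs_pinfty_ge; rewrite num_real.
Unshelve. all: by end_near. Qed.

Fact contlin_submod : submod_closed contlin.
Proof.
split.
  apply/contlinP; split; first by move=> a x y; rewrite scaler0 addr0.
  by exists 0 => x; rewrite normr0 mul0r.
move=> a f g /contlinP[lf [C hC]] /contlinP[lg [C' hC']]; apply/contlinP; split.
  move=> b x y; rewrite -[LHS]/(a *: f (b *: x + y) + g (b *: x + y)).
  rewrite lf lg -[(_ + g) x]/(a *: f x + g x) -[(_ + g) y]/(a *: f y + g y).
  by rewrite !scalerDr addrACA !scalerA [a * b]mulrC.
exists (`|a| * C + C') => x; rewrite -[(_ + g) x]/(a *: f x + g x).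
rewrite (le_trans (ler_normD _ _))// mulrDl lerD// normrZ -mulrA.
by rewrite ler_wpM2l.
Qed.
HB.instance Definition _ :=
  GRing.isSubmodClosed.Build R (V -> R^o) contlin contlin_submod.

Record dual :=
  Dual { dual_fun :> V -> R^o ; dual_contlin : dual_fun \in contlin }.
HB.instance Definition _ := [isSub for dual_fun].
HB.instance Definition _ := [Choice of dual by <:].
HB.instance Definition _ := [SubChoice_isSubLmodule of dual by <:].

Definition dual_norm (f : dual) : R :=
  sup [set `|f x| | x in [set x | `|x| <= 1]].

Lemma dual_linear (f : dual) : linear f.
Proof. by have /contlinP[] := dual_contlin f. Qed.
HB.instance Definition _ (f : dual) :=
  GRing.isLinear.Build R V R^o _ f (dual_linear f).

Let dual_norm_ub1 (f : dual) x : `|x| <= 1 -> `|f x| <= dual_norm f.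
Proof.
move=> x1; apply: ub_le_sup; last by exists x.
have /contlinP[_ [C hC]] := dual_contlin f; exists `|C| => _ [z /= z1 <-].
rewrite (le_trans (hC _))// (le_trans (ler_wpM2r _ (ler_norm C)))//.
by rewrite ler_piMr.
Qed.

Lemma dual_norm_ub (f : dual) x : `|f x| <= dual_norm f * `|x|.
Proof.
have [->|x0] := eqVneq x 0; first by rewrite linear0 !normr0 mulr0.
have := dual_norm_ub1 f (x := `|x|^-1 *: x).
rewrite linearZ/= !normrZ normfV normr_id mulVf ?normr_eq0// lexx.
by rewrite ler_pdivrMl ?normr_gt0// mulrC; exact.
Qed.

Lemma dual_norm_le (f : dual) (M : R) :
  (forall x, `|x| <= 1 -> `|f x| <= M) -> dual_norm f <= M.
Proof.
move=> hM; apply: ge_sup; last by move=> _ [y y1 <-]; exact: hM.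
by exists `|f 0|, 0 => //=; rewrite normr0.
Qed.

Lemma dual_norm_ge0 f : 0 <= dual_norm f.
Proof.
by rewrite (le_trans (normr_ge0 (f 0)))// dual_norm_ub1// normr0.
Qed.

Lemma dualD (f g : dual) x : (f + g) x = f x + g x. Proof. by []. Qed.
Lemma dualN (f : dual) x : (- f) x = - f x. Proof. by []. Qed.
Lemma dualZ a (f : dual) x : (a *: f) x = a *: f x. Proof. by []. Qed.

Fact dual_normD f g : dual_norm (f + g) <= dual_norm f + dual_norm g.
Proof.
apply: dual_norm_le => x x1.
by rewrite (le_trans (ler_normD _ _))// lerD ?dual_norm_ub1.
Qed.

Let dual_normZle (a : R) f : dual_norm (a *: f) <= `|a| * dual_norm f.
Proof.
by apply: dual_norm_le => x x1; rewrite dualZ normrZ ler_wpM2l ?dual_norm_ub1.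
Qed.

Fact dual_normZ (a : R) f : dual_norm (a *: f) = `|a| * dual_norm f.
Proof.
apply/eqP; rewrite eq_le dual_normZle/=.
have [->|a0] := eqVneq a 0; first by rewrite normr0 mul0r dual_norm_ge0.
rewrite -ler_pdivlMl ?normr_gt0// -normfV.
by rewrite (le_trans _ (dual_normZle _ _))// scalerA mulVf// scale1r.
Qed.

Fact dual_norm_eq0 f : dual_norm f = 0 -> f = 0.
Proof.
move=> f0; apply: val_inj; apply/funext => x /=; apply/eqP.
by rewrite -normr_le0 (le_trans (dual_norm_ub _ _))// f0 mul0r.
Qed.

HB.instance Definition _ := @Lmodule_isNormed.Build R dual
  dual_norm dual_normD dual_normZ dual_norm_eq0.

Lemma dual_normE (f : dual) :
  `|f| = sup [set `|f x| | x in [set x | `|x| <= 1]].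
Proof. by []. Qed.
Lemma dual_ub (f : dual) x : `|f x| <= `|f| * `|x|.
Proof. exact: dual_norm_ub. Qed.
Lemma dual_le (f : dual) (M : R) :
  (forall x, `|x| <= 1 -> `|f x| <= M) -> `|f| <= M.
Proof. exact: dual_norm_le. Qed.

Fact dual_complete (F : set_system dual) : ProperFilter F -> cauchy F -> cvg F.
Proof.
move=> FF /cauchy_ballP Fc.
have {}Fc e : 0 < e -> exists f0 : dual, F [set f : dual | `|f0 - f| <= e].
  move=> e0; have /cauchy_ballP/cauchyP/(_ e e0)[f0 hf0] := Fc.
  exists f0; apply: filterS hf0 => f; rewrite -ball_normE /ball_/= => /ltW.
  by [].
have cF x : cvg ((f : dual) x @[f --> F]).
  apply: cauchy_cvg; apply: cauchy_exP => e e0.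
  have e1 : 0 < e / (`|x| + 1) by rewrite divr_gt0// ltr_wpDl.
  have [f0 hf0] := Fc _ e1; exists (f0 x); rewrite /= near_simpl.
  apply: filterS hf0 => f /= hf; rewrite -ball_normE /ball_/=.
  rewrite -[f0 x - f x]/((f0 - f) x) (le_lt_trans (dual_ub _ _))//.
  rewrite (le_lt_trans (ler_wpM2r _ hf))// mulrAC ltr_pdivrMr ?ltr_wpDl//.
  by rewrite ltr_pM2l// ltrDl.
pose l (x : V) : R^o := lim ((f : dual) x @[f --> F]).
have lc e : 0 < e -> exists f0 : dual, F [set f : dual | `|f0 - f| <= e] /\
    forall x, `|f0 x - l x| <= e * `|x|.
  move=> e0; have [f0 hf0] := Fc _ e0; exists f0; split=> // x.
  have clx : `|f0 x - (f : dual) x| @[f --> F] --> `|f0 x - l x|.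
    by apply: cvg_norm; apply: cvgB; [exact: cvg_cst|exact: cF].
  rewrite -(cvg_lim _ clx)//; apply: limr_le.
    by apply/cvg_ex; eexists; exact: clx.
  apply: filterS hf0 => f /= hf; rewrite -[f0 x - f x]/((f0 - f) x).
  by rewrite (le_trans (dual_ub _ _))// ler_wpM2r.
have llin : linear l.
  move=> a x y; apply: cvg_lim => //.
  under eq_cvg do rewrite linearP.
  by apply: cvgD; [apply: cvgZr|]; exact: cF.
have hl : l \in contlin.
  apply/contlinP; split=> //; have [f0 [_ hf0]] := lc 1 ltr01.
  exists (`|f0| + 1) => x; rewrite mulrDl -[l x](subKr (f0 x)).
  rewrite (le_trans (ler_normB _ _))// lerD ?dual_ub//.
apply/cvg_ex; exists (Dual hl); apply/cvgrPdist_le => e e0.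
have e2 : 0 < e / 2 by rewrite divr_gt0.
have [f0 [hf0 hl0]] := lc _ e2; apply: filterS hf0 => f /= hf.
apply: dual_le => x x1; rewrite -[_ x]/(l x - f x).
rewrite -(subrKA (f0 x)) (le_trans (ler_normD _ _))// [leRHS](splitr e).
rewrite lerD//.
  by rewrite distrC (le_trans (hl0 _))// ler_piMr// ltW.
rewrite -[f0 x - f x]/((f0 - f) x) (le_trans (dual_ub _ _))//.
by rewrite (le_trans (ler_wpM2r _ hf))// ler_piMr// ltW.
Qed.

HB.instance Definition _ := Uniform_isComplete.Build dual dual_complete.

End Dual.

Section PostComposition.
Context {R : realType}.

Definition contractive (V W : normedModType R) (T : V -> W) :=
  forall v, `|T v| <= `|v|.

Section Linf.
Context {X : Type} {V W : normedModType R} (T : {linear V -> W}).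
Context (hT : contractive T).

Fact linf_post_bdd (f : linf X V) : T \o f \in @bddfun R X W.
Proof.
by apply/asboolP; exists `|f| => x; exact: le_trans (hT _) (linf_ub _ _).
Qed.

Definition linf_post (f : linf X V) : linf X W := Linf (linf_post_bdd f).

Fact linf_post_linear : linear linf_post.
Proof.
by move=> a f g; apply: val_inj; apply/funext => x; exact: linearP.
Qed.
HB.instance Definition _ :=
  GRing.isLinear.Build R (linf X V) (linf X W) _ linf_post linf_post_linear.

Lemma linf_post_norm f : `|linf_post f| <= `|f|.
Proof.
by apply: linf_le => // x; exact: le_trans (hT _) (linf_ub _ _).
Qed.
End Linf.

Section DualMap.
Context {V W : normedModType R} (T : {linear V -> W}) (hT : contractive T).

Fact dual_comp_contlin (l : dual W) : l \o T \in @contlin R V.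
Proof.
apply/contlinP; split; first by move=> a x y; rewrite /= !linearP.
exists `|l| => x; rewrite (le_trans (dual_ub _ _))// ler_wpM2l//; exact: hT.
Qed.

Definition dual_comp (l : dual W) : dual V := Dual (dual_comp_contlin l).

Fact dual_comp_linear : linear dual_comp.
Proof. by move=> a f g; apply: val_inj. Qed.
HB.instance Definition _ :=
  GRing.isLinear.Build R (dual W) (dual V) _ dual_comp dual_comp_linear.

Lemma dual_comp_contr : contractive dual_comp.
Proof.
move=> l; apply: dual_le => x x1; rewrite (le_trans (dual_ub l (T x)))//.
by rewrite ler_piMr// (le_trans (hT _)).
Qed.
End DualMap.

End PostComposition.

(** * Asymptotic modules *)

Section AsymptoticModules.
Context {R : realType}.

(** A contragredient [l \o pi_n(g^-1)] need not be norm-preserving at every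
    [n] when [pi_n(g^-1)] is not onto (the induced action forces surjectivity
    only on a set of [w]).  The underlying data therefore only ask for
    contractions; [asym_banach_module] below adds the remaining axioms. *)
Record asymSystem (G : groupType) := AsymSystem {
  as_space : nat -> completeNormedModType R ;
  as_act : forall n, G -> {linear as_space n -> as_space n} ;
  as_act_contr : forall n g, contractive (as_act n g) }.

Definition as_family G (V : asymSystem G) : nat -> normedModType R :=
  fun n => as_space V n.

Fact act_bound G (V : asymSystem G) (g : dseq (fun=> G)) :
  exists C : R, forall n (v : as_space V n), `|as_act V n (g n) v| <= C * `|v|.
Proof. by exists 1 => n v; rewrite mul1r; exact: as_act_contr. Qed.

Definition act_bop G (V : asymSystem G) (g : dseq (fun=> G)) :
  bop (as_family V) (as_family V) := Bop (act_bound V g).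

(** The map of [V_b / V_inf] induced by [g : *G]; it does not depend on the
    representative of [g], see [tactE]. *)
Definition tact w G (V : asymSystem G) (g : upow w G) :
    {linear utilde w (as_family V) -> utilde w (as_family V)} :=
  tmor w (act_bop V (repr g)).

Lemma tactE w G (V : asymSystem G) (g : dseq (fun=> G)) v hv : exists hgv,
  tact V (ucls w g : upow w G) (@tcls R w (as_family V) v hv) =
  @tcls R w (as_family V) (fun n => as_act V n (g n) (v n)) hgv.
Proof.
have [h1 E1] := tmorE (act_bop V (repr (ucls w g : upow w G))) hv.
have [h2 _] := tmorE (act_bop V g) hv.
exists h2; rewrite /tact E1; apply: tcls_ae.
by apply: filterS (repr_ucls w g) => n /= ->.
Qed.

(** Linearity of the induced action is part of the type of [tact], and that it
    is isometric follows from the first clause. *)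
Definition asym_banach_module w G (V : asymSystem G) : Prop :=
  [/\ forall n g v, `|as_act V n g v| = `|v|,
      forall x, tact V (1%g : upow w G) x = x &
      forall (g h : upow w G) x, tact V (g * h)%g x = tact V g (tact V h x)].

(** The internal dual with the contragredient action
    [(g, l) |-> l \o pi_n(g^-1)]. *)
Definition dual_system G (V : asymSystem G) : asymSystem G :=
  @AsymSystem G (fun n => dual (as_space V n))
    (fun n g => dual_comp (@as_act_contr G V n g^-1%g))
    (fun n g => dual_comp_contr (@as_act_contr G V n g^-1%g)).

Definition dual_asym_banach_module w G (V : asymSystem G) : Prop :=
  exists2 V0 : asymSystem G, asym_banach_module w V0 & V = dual_system V0.

Definition res_system (G Q : groupType) (p : G -> Q) (V : asymSystem Q) :
    asymSystem G :=
  @AsymSystem G (as_space V) (fun n g => as_act V n (p g))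
    (fun n g => @as_act_contr Q V n (p g)).

End AsymptoticModules.

(** * Asymptotic cohomology *)

Section AsymptoticCohomology.
Context {R : realType} (w : freeUltrafilter).

Section Cochains.
Context {G : groupType} (V : asymSystem (R := R) G).

(** [G^m] is ['I_m -> G]. *)
Definition cochain_family (m : nat) : nat -> normedModType R :=
  fun n => linf ('I_m -> G) (as_family V n).

Definition cochain (m : nat) := utilde w (cochain_family m).
HB.instance Definition _ m := GRing.Lmodule.on (cochain m).

Definition linf_act m n (g : G) :
    {linear cochain_family m n -> cochain_family m n} :=
  linf_post (@as_act_contr R G V n g) \o
  linf_comp (fun (x : 'I_m -> G) i => (g^-1 * x i)%g).

Fact linf_act_bound m (g : dseq (fun=> G)) :
  exists C : R, forall n f, `|linf_act m n (g n) f| <= C * `|f|.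
Proof.
exists 1 => n f; rewrite mul1r.
exact: le_trans (linf_post_norm _ _) (linf_comp_norm _ _).
Qed.

Definition linf_act_bop m (g : dseq (fun=> G)) :
  bop (cochain_family m) (cochain_family m) := Bop (linf_act_bound m g).

Definition cochain_act m (g : upow w G) : {linear cochain m -> cochain m} :=
  tmor w (linf_act_bop m (repr g)).

Lemma cochain_actE m (g : dseq (fun=> G)) f hf : exists hgf,
  cochain_act m (ucls w g : upow w G) (@tcls R w (cochain_family m) f hf) =
  @tcls R w (cochain_family m) (fun n => linf_act m n (g n) (f n)) hgf.
Proof.
have [h1 E1] := tmorE (linf_act_bop m (repr (ucls w g : upow w G))) hf.
have [h2 _] := tmorE (linf_act_bop m g) hf.
exists h2; rewrite /cochain_act E1; apply: tcls_ae.
by apply: filterS (repr_ucls w g) => n /= ->.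
Qed.

Definition invariants m : {pred cochain m} :=
  fun x => `[< forall g, cochain_act m g x = x >].

Definition linf_d m n (f : cochain_family m n) : cochain_family m.+1 n :=
  \sum_(j < m.+1)
    (-1) ^+ j *: linf_comp (fun (x : 'I_m.+1 -> G) i => x (lift j i)) f.

Fact linf_d_linear m n : linear (@linf_d m n).
Proof.
move=> a f g; rewrite /linf_d scaler_sumr -big_split/=; apply: eq_bigr => j _.
by rewrite linearP scalerDr !scalerA mulrC.
Qed.
HB.instance Definition _ m n :=
  GRing.isLinear.Build R (cochain_family m n) (cochain_family m.+1 n) _
    (@linf_d m n) (@linf_d_linear m n).

Fact linf_d_bound m :
  exists C : R, forall n f, `|@linf_d m n f| <= C * `|f|.
Proof.
exists m.+1%:R => n f; rewrite (le_trans (ler_norm_sum _ _ _))//.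
rewrite [leRHS](_ : _ = \sum_(j < m.+1) `|f|); last first.
  by rewrite sumr_const card_ord mulr_natl.
apply: ler_sum => j _; rewrite normrZ normrX normrN1 expr1n mul1r.
exact: linf_comp_norm.
Qed.

Definition linf_d_bop m : bop (cochain_family m) (cochain_family m.+1) :=
  Bop (linf_d_bound m).

Definition cochain_d m : {linear cochain m -> cochain m.+1} :=
  tmor w (linf_d_bop m).

Definition cocycle n : {pred cochain n.+1} :=
  fun x => `[< x \in @invariants n.+1 /\ cochain_d n.+1 x = 0 >].

(** In degree 0 the incoming differential is the zero map from the zero
    module. *)
Definition coboundary n : {pred cochain n.+1} :=
  match n with
  | 0 => fun x => `[< x = 0 >]
  | k.+1 => fun x =>
      `[< exists2 y, y \in @invariants k.+1 & cochain_d k.+1 y = x >]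
  end.

Fact invariants_submod m : submod_closed (@invariants m).
Proof.
split; first by apply/asboolP => g; rewrite linear0.
move=> a x y /asboolP hx /asboolP hy; apply/asboolP => g.
by rewrite linearP hx hy.
Qed.
HB.instance Definition _ m :=
  GRing.isSubmodClosed.Build R (cochain m) (@invariants m)
    (invariants_submod m).

Fact cocycle_submod n : submod_closed (@cocycle n).
Proof.
split; first by apply/asboolP; rewrite rpred0 linear0.
move=> a x y /asboolP[hx dx] /asboolP[hy dy]; apply/asboolP; split.
  by rewrite rpredD ?rpredZ.
by rewrite linearP dx dy scaler0 addr0.
Qed.
HB.instance Definition _ n :=
  GRing.isSubmodClosed.Build R (cochain n.+1) (@cocycle n) (cocycle_submod n).

Fact coboundary_submod n : submod_closed (@coboundary n).
Proof.
case: n => [|n].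
  split; first exact/asboolP.
  by move=> a x y /asboolP -> /asboolP ->; apply/asboolP; rewrite scaler0 addr0.
split; first by apply/asboolP; exists 0; rewrite ?rpred0 ?linear0.
move=> a _ _ /asboolP[x hx <-] /asboolP[y hy <-]; apply/asboolP.
by exists (a *: x + y); rewrite ?linearP ?rpredD ?rpredZ.
Qed.
HB.instance Definition _ n :=
  GRing.isSubmodClosed.Build R (cochain n.+1) (@coboundary n)
    (coboundary_submod n).

Definition asym_cohomology n := subquot (@cocycle n) (@coboundary n).
HB.instance Definition _ n := GRing.Lmodule.on (asym_cohomology n).

End Cochains.

Section Pullback.
Context {G Q : groupType} (p : UMagmaMorphism.type G Q).
Context (V : asymSystem (R := R) Q).

Definition linf_pull m n :
    {linear cochain_family V m n -> cochain_family (res_system p V) m n} :=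
  linf_comp (fun (x : 'I_m -> G) i => p (x i)).

Fact linf_pull_bound m :
  exists C : R, forall n f, `|linf_pull m n f| <= C * `|f|.
Proof. by exists 1 => n f; rewrite mul1r; exact: linf_comp_norm. Qed.

Definition linf_pull_bop m :
    bop (cochain_family V m) (cochain_family (res_system p V) m) :=
  Bop (linf_pull_bound m).

Definition cochain_pull m :
    {linear cochain V m -> cochain (res_system p V) m} :=
  tmor w (linf_pull_bop m).

Lemma linf_d_pull m n f :
  @linf_d G (res_system p V) m n (linf_pull m n f) =
  linf_pull m.+1 n (linf_d f).
Proof.
rewrite /linf_d /linf_pull linear_sum; apply: eq_bigr => j _.
by rewrite linearZ; congr (_ *: _); apply: val_inj.
Qed.

Lemma linf_act_pull m n g f :
  @linf_act G (res_system p V) m n g (linf_pull m n f) =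
  linf_pull m n (linf_act V m n (p g) f).
Proof.
apply: val_inj; apply/funext => x /=; congr (as_act V n (p g) (f _)).
by apply/funext => i; rewrite gmulfM gmulfV.
Qed.

Lemma cochain_d_pull m x :
  cochain_d (res_system p V) m (cochain_pull m x) =
  cochain_pull m.+1 (cochain_d V m x).
Proof.
have [f [hf ->]] := tcls_surj x.
have [h1 ->] := tmorE (linf_pull_bop m) hf.
have [h2 ->] := tmorE (linf_d_bop (res_system p V) m) h1.
have [h3 ->] := tmorE (linf_d_bop V m) hf.
have [h4 ->] := tmorE (linf_pull_bop m.+1) h3.
by apply: tcls_ae; apply: filterS filterT => n _; exact: linf_d_pull.
Qed.

Lemma cochain_act_pull m (g : upow w G) x :
  cochain_act (res_system p V) m g (cochain_pull m x) =
  cochain_pull m (cochain_act V m (umap (fun _ => p) g : upow w Q) x).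
Proof.
have [f [hf ->]] := tcls_surj x.
have [h1 ->] := tmorE (linf_pull_bop m) hf.
have [h2 ->] := tmorE (linf_act_bop (res_system p V) m (repr g)) h1.
have [h3 ->] :=
  tmorE (linf_act_bop V m (repr (umap (fun _ => p) g : upow w Q))) hf.
have [h4 ->] := tmorE (linf_pull_bop m) h3.
apply: tcls_ae; apply: filterS (repr_ucls w (fun n => p (repr g n))).
by move=> n /= ->; exact: linf_act_pull.
Qed.

Lemma invariants_pull m x :
  x \in @invariants Q V m ->
  cochain_pull m x \in @invariants G (res_system p V) m.
Proof.
by move=> /asboolP hx; apply/asboolP => g; rewrite cochain_act_pull hx.
Qed.

Lemma cocycle_pull n x : x \in @cocycle Q V n ->
  cochain_pull n.+1 x \in @cocycle G (res_system p V) n.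
Proof.
move=> /asboolP[hx dx]; apply/asboolP; split; first exact: invariants_pull.
by rewrite cochain_d_pull dx linear0.
Qed.

Lemma coboundary_pull n x : x \in @coboundary Q V n ->
  cochain_pull n.+1 x \in @coboundary G (res_system p V) n.
Proof.
case: n x => [|n] x /asboolP.
  by move=> ->; apply/asboolP; rewrite linear0.
move=> [y hy <-]; apply/asboolP; exists (cochain_pull n.+1 y).
  exact: invariants_pull.
by rewrite cochain_d_pull.
Qed.

Definition pullback n :
    {linear asym_cohomology V n -> asym_cohomology (res_system p V) n} :=
  sqmap (@cocycle_pull n) (fun x _ => @coboundary_pull n x).

End Pullback.
End AsymptoticCohomology.

(** * Quotient groups and amenability *)

Record normalSubgroup (G : groupType) := NormalSubgroup {
  ns_pred :> groupClosed G ;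
  ns_normal : forall x y : G,
    x \in (ns_pred : {pred G}) -> (x ^ y)%g \in (ns_pred : {pred G}) }.

Section Subgroup.
Context {G : groupType} (N : groupClosed G).
Record subgroup :=
  Subgroup { subgroup_val :> G ;
             subgroup_valP : subgroup_val \in (N : {pred G}) }.
HB.instance Definition _ := [isSub for subgroup_val].
HB.instance Definition _ := [Choice of subgroup by <:].
Fact subgroup_closed : group_closed (N : {pred G}).
Proof. by split; [exact: gpred1|exact: gpredF]. Qed.
HB.instance Definition _ :=
  SubChoice_isSubGroup.Build G _ subgroup subgroup_closed.
End Subgroup.

Section QuotientGroup.
Context {G : groupType} (N : normalSubgroup G).

Definition cosetrel (x y : G) : bool := (x^-1 * y)%g \in (N : {pred G}).

Lemma cosetrel_equiv : equiv_class_of cosetrel.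
Proof.
split=> [x|x y|y x z]; rewrite /cosetrel ?mulVg ?gpred1//.
  by rewrite -gpredV invgM invgK.
by move=> xy yz; rewrite -(mulVKg y z) mulgA gpredM.
Qed.

Canonical cosetrel_equiv_rel := EquivRelPack cosetrel_equiv.

Definition quotient_group := {eq_quot cosetrel}.
HB.instance Definition _ := EqQuotient.on quotient_group.
HB.instance Definition _ := Choice.on quotient_group.

Definition qproj (x : G) : quotient_group := \pi x.

Lemma qproj_surj q : exists x, q = qproj x.
Proof. by exists (repr q); rewrite /qproj reprK. Qed.

Lemma qproj_eq x y : qproj x = qproj y <-> (x^-1 * y)%g \in (N : {pred G}).
Proof.
split; first by move/eqP; rewrite /qproj eqmodE.
by move=> h; apply/eqP; rewrite /qproj eqmodE.
Qed.

Lemma repr_qproj x : (x^-1 * repr (qproj x))%g \in (N : {pred G}).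
Proof. by apply/qproj_eq; rewrite [RHS]/qproj reprK. Qed.

Definition qmul (p q : quotient_group) : quotient_group :=
  qproj (repr p * repr q).
Definition qinv (p : quotient_group) : quotient_group := qproj (repr p)^-1.

Lemma qmulE x y : qmul (qproj x) (qproj y) = qproj (x * y).
Proof.
apply/esym/qproj_eq; have := repr_qproj x; have := repr_qproj y.
move: (repr _) (repr _) => x' y' hy hx.
have -> : ((x * y)^-1 * (x' * y') = (x^-1 * x') ^ y * (y^-1 * y'))%g.
  by rewrite /conjg invgM !mulgA mulgK.
by rewrite gpredM// ns_normal.
Qed.

Lemma qinvE x : qinv (qproj x) = qproj x^-1.
Proof.
apply/esym/qproj_eq; have := repr_qproj x; move: (repr _) => x' hx.
rewrite -gpredV in hx.
have -> : ((x^-1)^-1 * x'^-1 = ((x^-1 * x')^-1) ^ (x^-1))%g.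
  by rewrite /conjg invgM !invgK !mulgA mulgK.
exact: ns_normal.
Qed.

Fact qmulA : associative qmul.
Proof.
move=> p q r; have [x ->] := qproj_surj p; have [y ->] := qproj_surj q.
have [z ->] := qproj_surj r.
by rewrite (qmulE x y) (qmulE y z) !qmulE mulgA.
Qed.
Fact qmul1l : left_id (qproj 1) qmul.
Proof. by move=> p; have [x ->] := qproj_surj p; rewrite qmulE mul1g. Qed.
Fact qmul1r : right_id (qproj 1) qmul.
Proof. by move=> p; have [x ->] := qproj_surj p; rewrite qmulE mulg1. Qed.
Fact qmulVl : left_inverse (qproj 1) qinv qmul.
Proof. by move=> p; have [x ->] := qproj_surj p; rewrite qinvE qmulE mulVg. Qed.
Fact qmulVr : right_inverse (qproj 1) qinv qmul.
Proof. by move=> p; have [x ->] := qproj_surj p; rewrite qinvE qmulE mulgV. Qed.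
HB.instance Definition _ :=
  isGroup.Build quotient_group qmulA qmul1l qmul1r qmulVl qmulVr.

Fact qprojM : {morph qproj : x y / (x * y)%g >-> (x * y)%g}.
Proof. by move=> x y; rewrite [RHS]qmulE. Qed.
Fact qproj1 : qproj 1 = 1%g. Proof. by []. Qed.
HB.instance Definition _ :=
  isUMagmaMorphism.Build G quotient_group qproj (qproj1, qprojM).

End QuotientGroup.

(** [G] carries a left-invariant mean. *)
Definition amenable (R : realType) (G : groupType) : Prop :=
  exists m : {linear linf G R^o -> R^o},
    [/\ forall f : linf G R^o, (forall x, 0 <= f x) -> 0 <= m f,
        forall f : linf G R^o, (forall x, f x = 1) -> m f = 1 &
        forall (g : G) (f : linf G R^o),
          m (linf_comp (fun x => g * x)%g f) = m f].

(* Main.v *)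
(** A left-invariant mean on [N], iterated [m] times and taken in the weak-*
    sense, averages [f(x_1 t_1, .., x_m t_m)] over [t] in [N^m]. By invariance
    the result depends only on the cosets [x_i N], so it defines a map [A] from
    the cochains of [Gamma] to those of [Gamma / N] with [A \o p^* = id].
    Averaging the prism operator
      [\sum_j (-1)^j f(x_1, .., x_j, x_j t_j, .., x_m t_m)]
    gives a chain homotopy between [id] and [p^* \o A]. All these identities are
    exact and equivariant at every level [n] of the ultraproduct, the
    contragredient action commuting with weak-* means. *)

Require Import Defs.
From HB Require Import structures.
From mathcomp Require Import all_boot all_order all_algebra.
From mathcomp Require Import boolp classical_sets functions cardinality filter.
From mathcomp Require Import reals topology normedtype.

Set Implicit Arguments.
Unset Strict Implicit.
Unset Printing Implicit Defensive.

Import Order.TTheory GRing.Theory Num.Theory.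
Import numFieldNormedType.Exports.

Local Open Scope classical_set_scope.
Local Open Scope ring_scope.

(** * Tuples as functions on ordinals: prepending and deleting entries *)

Section FiniteSequences.
Context {X : Type}.

Definition fcons m (a : X) (t : 'I_m -> X) : 'I_m.+1 -> X :=
  fun i => if unlift ord0 i is Some j then t j else a.

Lemma fcons0 m a (t : 'I_m -> X) : fcons a t ord0 = a.
Proof. by rewrite /fcons unlift_none. Qed.

Lemma fconsS m a (t : 'I_m -> X) j : fcons a t (lift ord0 j) = t j.
Proof. by rewrite /fcons liftK. Qed.

Lemma fcons_behead m a (t : 'I_m -> X) : (fun j => fcons a t (lift ord0 j)) = t.
Proof. by apply/funext => j; exact: fconsS. Qed.

Lemma fconsP m (x : 'I_m.+1 -> X) : exists a t, x = fcons a t.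
Proof.
exists (x ord0), (fun j => x (lift ord0 j)); apply/funext => i.
by case: (unliftP ord0 i) => [j|] ->; rewrite ?fconsS ?fcons0.
Qed.

(** Deleting an entry of the tail does not touch the head, so faces can be treated by induction on
    the length. *)
Lemma fcons_lift m a (t : 'I_m.+1 -> X) (j : 'I_m.+1) :
  (fun i => fcons a t (lift (lift ord0 j) i)) = fcons a (fun i => t (lift j i)).
Proof.
apply/funext => i; case: (unliftP ord0 i) => [k|] ->.
  rewrite fconsS; suff -> : lift (lift ord0 j) (lift ord0 k) =
    lift ord0 (lift j k) by rewrite fconsS.
  by apply: val_inj; rewrite /= /bump !add1n ltnS addnS.
by rewrite fcons0; have -> : lift (lift ord0 j) ord0 = ord0;
  [exact: val_inj|rewrite fcons0].
Qed.

End FiniteSequences.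

Lemma fcons_map (X Y : Type) (phi : X -> Y) m a (t : 'I_m -> X) :
  (fun i => phi (fcons a t i)) = fcons (phi a) (fun i => phi (t i)).
Proof.
by apply/funext => i; case: (unliftP ord0 i) => [j|] ->; rewrite ?fconsS ?fcons0.
Qed.

(** * The alternating face sum and the prism operator, without boundedness *)

Section Prism.
Context {R : nzRingType} {V : lmodType R}.

Definition alt (X : Type) m (f : ('I_m -> X) -> V) (x : 'I_m.+1 -> X) : V :=
  \sum_(j < m.+1) (-1) ^+ j *: f (fun i => x (lift j i)).

(** The face deleting the head is split off; in the other faces the index drops by one, whence the
    sign. The recursion matches that of [prism]. *)
Lemma alt_cons (X : Type) m (f : ('I_m.+1 -> X) -> V) a (t : 'I_m.+1 -> X) :
  alt f (fcons a t) = f t - alt (fun s => f (fcons a s)) t.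
Proof.
rewrite /alt big_ord_recl/= expr0 scale1r fcons_behead -sumrN; congr (_ + _).
apply: eq_bigr => j _; rewrite fcons_lift /bump/= add1n exprS mulN1r.
by rewrite scaleNr.
Qed.

Lemma alt0 (X : Type) (f : ('I_0 -> X) -> V) x :
  alt f x = f (fun i => x (lift ord0 i)).
Proof. by rewrite /alt big_ord_recl big_ord0 addr0 expr0 scale1r. Qed.

(** [\sum_j (-1)^j f(x_0, .., x_j, y_j, .., y_(m-1))] for
    [z = ((x_0, y_0), .., (x_(m-1), y_(m-1)))]. *)
Fixpoint prism (X : Type) m :
    (('I_m.+1 -> X) -> V) -> ('I_m -> X * X) -> V :=
  match m with
  | 0 => fun _ _ => 0
  | k.+1 => fun f z =>
      f (fcons (z ord0).1 (fun i => (z i).2)) -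
      prism (fun s => f (fcons (z ord0).1 s)) (fun i => z (lift ord0 i))
  end.

Lemma prism_cons (X : Type) m (f : ('I_m.+2 -> X) -> V) x y
    (z : 'I_m -> X * X) :
  prism f (fcons (x, y) z) =
  f (fcons x (fcons y (fun i => (z i).2))) - prism (fun s => f (fcons x s)) z.
Proof. by rewrite /= fcons0 fcons_behead fcons_map. Qed.

Lemma altB (X : Type) m (f g : ('I_m -> X) -> V) x :
  alt (fun s => f s - g s) x = alt f x - alt g x.
Proof. by rewrite /alt -sumrB; apply: eq_bigr => j _; rewrite scalerBr. Qed.

Lemma prismP (X : Type) m a (f g : ('I_m.+1 -> X) -> V) z :
  prism (fun s => a *: f s + g s) z = a *: prism f z + prism g z.
Proof.
elim: m f g z => [|m IH] f g z /=; first by rewrite scaler0 addr0.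
by rewrite IH opprD scalerBr addrACA.
Qed.

Lemma prismB (X : Type) m (f g : ('I_m.+1 -> X) -> V) z :
  prism (fun s => f s - g s) z = prism f z - prism g z.
Proof.
transitivity (prism (fun s => (-1) *: g s + f s) z).
  by congr prism; apply/funext => s; rewrite scaleN1r addrC.
by rewrite prismP scaleN1r addrC.
Qed.

(** By induction on [m]: once the first pair [(x, y)] is peeled off, both sides are governed by the
    identity for [f (fcons x _)], and the other terms cancel. *)
Lemma prism_homotopy (X : Type) m (f : ('I_m.+1 -> X) -> V)
    (z : 'I_m.+1 -> X * X) :
  prism (alt f) z + alt (prism f) z =
  f (fun i => (z i).2) - f (fun i => (z i).1).
Proof.
elim: m f z => [|m IH] f z; have [[x y] [{}z ->]] := fconsP z.
  rewrite prism_cons/= alt0/= addr0 subr0 alt_cons alt0 fcons_behead !fcons_map.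
  congr (f _ - f _).
  by congr fcons; apply/funext => -[].
rewrite prism_cons (alt_cons (prism f)) (alt_cons f).
have -> : (fun t => prism f (fcons (x, y) t)) = (fun t =>
    f (fcons x (fcons y (fun i => (t i).2))) - prism (fun s => f (fcons x s)) t).
  by apply/funext => t; rewrite prism_cons.
have -> : (fun s => alt f (fcons x s)) =
    (fun s => f s - alt (fun s => f (fcons x s)) s).
  by apply/funext => t; rewrite alt_cons.
rewrite altB prismB alt_cons !fcons_map.
rewrite [(x, y).1]/= [(x, y).2]/=.
(* The induction hypothesis with the first vertex frozen at [x], solved for the prism of the face
   sum. *)
have /(canRL (addrK _)) -> := IH (fun s => f (fcons x s)) z.
set a := f (fcons y _); set b := f (fcons x (fun i => (z i).1)).
set c := f (fcons x _); set d := alt _ _; set p := prism _ _; set q := alt _ _.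
(* The term [d] also occurs with the second projection taken inside the faces rather than before
   them; the two forms are convertible. What remains is abelian group algebra. *)
rewrite -[X in _ + (p - (X - q))]/d; clearbody a b c d p q.
rewrite !opprB -addrA [_ - p + _]addrA subrK [_ - q + _]addrA subrK.
by rewrite (addrAC c) -[c - d](opprB d) addrA addrK.
Qed.

End Prism.

(** Naturality in the coefficients; with [prism_comp], naturality in the vertices, it yields the
    equivariance of the homotopy. *)
Lemma prism_linear (R : nzRingType) (V W : lmodType R) (T : {linear V -> W}) X m
    (f : ('I_m.+1 -> X) -> V) z : prism (T \o f) z = T (prism f z).
Proof.
elim: m f z => [|m IH] f z /=; first by rewrite linear0.
by rewrite linearB -IH.
Qed.

Lemma prism_comp (R : nzRingType) (V : lmodType R) X Y (phi : X -> Y) m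
    (f : ('I_m.+1 -> Y) -> V) z :
  prism (fun x => f (fun i => phi (x i))) z =
  prism f (fun i => (phi (z i).1, phi (z i).2)).
Proof.
elim: m f z => [|m IH] f z //=; rewrite fcons_map -IH.
by congr (_ - prism _ _); apply/funext => s; rewrite fcons_map.
Qed.

(** * Means on sets, their finite powers, and weak-* averages *)

Section Means.
Context {R : realType}.

(** Positivity is replaced by its consequence [mean_norm], the form that passes to averages of
    dual-valued functions. *)
Record mean (X : Type) := Mean {
  mean_fun :> linf X R^o -> R^o ;
  mean_linear : linear mean_fun ;
  mean_norm : forall f, `|mean_fun f| <= `|f| ;
  mean_cst : forall (c : R^o) (f : linf X R^o),
    (forall x, f x = c) -> mean_fun f = c }.

HB.instance Definition _ X (mu : mean X) :=
  GRing.isLinear.Build R (linf X R^o) R^o _ mu (mean_linear mu).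

Fact linf_cst_bdd X (V : normedModType R) (c : V) :
  (fun=> c) \in @bddfun R X V.
Proof. by apply/asboolP; exists `|c|. Qed.

Definition linf_cst X (V : normedModType R) (c : V) : linf X V :=
  Linf (linf_cst_bdd X c).

(** A positive unital functional is a contraction, because [f] and [- f] both lie below the constant
    [|f|]. *)
Lemma positive_mean (X : Type) (m : {linear linf X R^o -> R^o}) :
  (forall f : linf X R^o, (forall x, 0 <= f x) -> 0 <= m f) ->
  (forall f : linf X R^o, (forall x, f x = 1) -> m f = 1) ->
  exists mu : mean X, forall f, mu f = m f.
Proof.
move=> m0 m1.
have mC (c : R^o) (f : linf X R^o) : (forall x, f x = c) -> m f = c.
  move=> fc; have -> : f = c *: linf_cst X (1 : R^o).
    by apply: val_inj; apply/funext => x; rewrite /= fc [RHS]mulr1.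
  by rewrite linearZ/= m1//; exact: mulr1.
have mle f : m f <= `|f|.
  rewrite -subr_ge0 -[X in X - _](mC `|f| (linf_cst X (`|f| : R^o)))//.
  rewrite -linearB m0// => x; rewrite linfD linfN subr_ge0.
  exact: le_trans (ler_norm _) (linf_ub f x).
have mn f : `|m f| <= `|f|.
  by rewrite ler_norml mle andbT lerNl -linearN (le_trans (mle _))// normrN.
by exists (Mean (linearP m) mn mC).
Qed.

Section ConsMean.
Context {X : Type} {m : nat} (mu : mean X) (nu : mean ('I_m -> X)).

Fact cons_section_bdd (f : linf ('I_m.+1 -> X) R^o) :
  (fun a => nu (linf_comp (fcons a) f)) \in @bddfun R X R^o.
Proof.
apply/asboolP; exists `|f| => x.
exact: le_trans (mean_norm _ _) (linf_comp_norm _ _).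
Qed.

Definition cons_section f : linf X R^o := Linf (cons_section_bdd f).

Fact cons_mean_linear : linear (fun f => mu (cons_section f)).
Proof.
move=> a f g; rewrite -linearP; congr (mu _).
by apply: val_inj; apply/funext => x /=; rewrite linearP linearP.
Qed.

Fact cons_mean_norm f : `|mu (cons_section f)| <= `|f|.
Proof.
rewrite (le_trans (mean_norm _ _))//; apply: linf_le => // x.
exact: le_trans (mean_norm _ _) (linf_comp_norm _ _).
Qed.

Fact cons_mean_cst c (f : linf ('I_m.+1 -> X) R^o) :
  (forall x, f x = c) -> mu (cons_section f) = c.
Proof. by move=> fc; apply: mean_cst => x; apply: mean_cst => t; apply: fc. Qed.

(** An iterated integral, the tail first. The order is fixed because Fubini can fail for finitely
    additive means. *)
Definition cons_mean : mean ('I_m.+1 -> X) :=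
  Mean cons_mean_linear cons_mean_norm cons_mean_cst.

End ConsMean.

Section NilMean.
Context {X : Type}.
Let nil : 'I_0 -> X := fun i => False_rect X (notF (ltn_ord i)).

Fact nil_mean_cst (c : R^o) (f : linf ('I_0 -> X) R^o) :
  (forall x, f x = c) -> f nil = c.
Proof. exact. Qed.

Definition nil_mean : mean ('I_0 -> X) :=
  @Mean _ (fun f => f nil) (fun a f g => erefl) (fun f => linf_ub f nil)
    nil_mean_cst.
End NilMean.

Fixpoint power_mean X (mu : mean X) m : mean ('I_m -> X) :=
  if m is k.+1 then cons_mean mu (power_mean mu k) else nil_mean.

(** The integrand is constant in the omitted variable, and a mean fixes constants. Induction carries
    the argument down to the [j]-th integral. *)
Lemma power_mean_face X (mu : mean X) m (j : 'I_m.+1) f :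
  power_mean mu m.+1 (linf_comp (fun t i => t (lift j i)) f) =
  power_mean mu m f.
Proof.
have E n (g : linf ('I_n.+1 -> X) R^o) :
    power_mean mu n.+1 g = mu (cons_section (power_mean mu n) g) by [].
have face0 n (g : linf ('I_n -> X) R^o) :
    power_mean mu n.+1 (linf_comp (fun t i => t (lift ord0 i)) g) =
    power_mean mu n g.
  rewrite E; apply: mean_cst => a; apply: (congr1 (power_mean mu n)).
  by apply: val_inj; apply/funext => t /=; rewrite fcons_behead.
elim: m j f => [|m IH] j f; case: (unliftP ord0 j) => [k|] -> //.
  by case: k.
rewrite !E; apply: (congr1 mu); apply: val_inj; apply/funext => a.
rewrite -[RHS](IH k (linf_comp (fcons a) f)).
apply: (congr1 (power_mean mu m.+1)); apply: val_inj; apply/funext => t /=.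
by rewrite fcons_lift.
Qed.

(** Each of the iterated integrals absorbs the translation of its own variable: the outer one by
    [inv], the inner ones by induction. *)
Lemma power_mean_invariant (G : groupType) (mu : mean G) m :
  (forall g f, mu (linf_comp (fun x => g * x)%g f) = mu f) ->
  forall (k : 'I_m -> G) f,
  power_mean mu m (linf_comp (fun t i => k i * t i)%g f) = power_mean mu m f.
Proof.
move=> inv; elim: m => [|m IH] k f.
  by apply: (congr1 (power_mean mu 0)); apply: val_inj; apply/funext => t /=;
    congr (f _); apply/funext => -[].
have [a [{}k ->]] := fconsP k.
rewrite -[RHS](inv a (cons_section (power_mean mu m) f)).
apply: (congr1 mu); apply: val_inj; apply/funext => b.
rewrite -[RHS](IH k (linf_comp (fcons (a * b)%g) f)).
apply: (congr1 (power_mean mu m)); apply: val_inj; apply/funext => t /=.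
congr (f _); apply/funext => i.
by case: (unliftP ord0 i) => [j|] ->; rewrite ?fconsS ?fcons0.
Qed.

(** The coefficients are duals so that bounded functions can be averaged. *)
Section WeakMean.
Context {T : Type} (mu : mean T) {W : normedModType R}.

Fact linf_eval_bdd (F : linf T (dual W)) (v : W) :
  (fun t => F t v) \in @bddfun R T R^o.
Proof.
apply/asboolP; exists (`|F| * `|v|) => t.
by rewrite (le_trans (dual_ub _ _))// ler_wpM2r// linf_ub.
Qed.

Definition linf_eval F v : linf T R^o := Linf (linf_eval_bdd F v).

Lemma linf_evalP a (F G : linf T (dual W)) v :
  linf_eval (a *: F + G) v = a *: linf_eval F v + linf_eval G v.
Proof.
apply: val_inj; apply/funext => t.
have E : linf_eval (a *: F + G) v t = (a *: F + G) t v by [].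
rewrite [LHS]E linfD linfZ dualD dualZ.
rewrite [RHS]linfD linfZ.
(* The two sides reach the structure of [R^o] through different instances,
   which unify quickly only when compared operation by operation. *)
apply: (congr2 +%R); last by [].
exact: (congr1 ( *:%R a)).
Qed.

Fact weak_mean_contlin F : (fun v => mu (linf_eval F v)) \in @contlin R W.
Proof.
apply/contlinP; split=> [a u v|].
  rewrite -linearP; congr (mu _); apply: val_inj; apply/funext => t /=.
  exact: linearP.
exists `|F| => v; rewrite (le_trans (mean_norm _ _))//.
apply: linf_le => [|t]; first by rewrite mulr_ge0.
by rewrite (le_trans (dual_ub _ _))// ler_wpM2r// linf_ub.
Qed.

(** The weak-* (Gelfand) integral of [F] against [mu]. *)
Definition weak_mean F : dual W := Dual (weak_mean_contlin F).

Lemma weak_mean_linear : linear weak_mean.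
Proof.
move=> a F G; apply: val_inj; apply/funext => v.
transitivity (mu (a *: linf_eval F v + linf_eval G v)); last exact: linearP.
by congr (mu _); exact: linf_evalP.
Qed.

Lemma weak_mean_norm F : `|weak_mean F| <= `|F|.
Proof.
apply: dual_le => v v1; rewrite (le_trans (mean_norm _ _))//.
apply: linf_le => // t; rewrite (le_trans (dual_ub _ _))//.
by rewrite (le_trans (ler_wpM2r _ (linf_ub F t)))// ler_piMr.
Qed.

Lemma weak_mean_cst c (F : linf T (dual W)) :
  (forall t, F t = c) -> weak_mean F = c.
Proof.
move=> Fc; apply: val_inj; apply/funext => v; apply: mean_cst => t /=.
by rewrite Fc.
Qed.

End WeakMean.

(** * Averaging bounded dual-valued functions along fibers *)

Section FiberMean.
Context {Y Z T : Type} (mu : mean T) {W : normedModType R}.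
Context (phi : Y -> T -> Z).

Fact fiber_mean_bdd (F : linf Z (dual W)) :
  (fun y => weak_mean mu (linf_comp (phi y) F)) \in @bddfun R Y (dual W).
Proof.
apply/asboolP; exists `|F| => y.
exact: le_trans (weak_mean_norm _ _) (linf_comp_norm _ _).
Qed.

(** The map [phi] is left free so that the descent to cosets and the homotopy are both instances. *)
Definition fiber_mean F : linf Y (dual W) := Linf (fiber_mean_bdd F).

Fact fiber_mean_linear : linear fiber_mean.
Proof.
move=> a F G; apply: val_inj; apply/funext => y /=.
by rewrite linearP weak_mean_linear.
Qed.
HB.instance Definition _ := GRing.isLinear.Build R (linf Z (dual W))
  (linf Y (dual W)) _ fiber_mean fiber_mean_linear.

Lemma fiber_mean_norm F : `|fiber_mean F| <= `|F|.
Proof.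
apply: linf_le => // y.
exact: le_trans (weak_mean_norm _ _) (linf_comp_norm _ _).
Qed.

End FiberMean.

(** * The prism operator on bounded functions *)

Section LinfPrism.
Context {X : Type} {m : nat} {V : normedModType R}.

(** The prism is a signed sum of [m] values of [f]. *)
Lemma prism_norm (f : linf ('I_m.+1 -> X) V) z : `|prism f z| <= m%:R * `|f|.
Proof.
elim: m f z => [|k IH] f z; first by rewrite normr0 mul0r.
rewrite -nat1r mulrDl mul1r (le_trans (ler_normB _ _))// lerD//.
  exact: linf_ub.
apply: le_trans (IH (linf_comp (fcons (z ord0).1) f) _) _.
by rewrite ler_wpM2l ?ler0n// linf_comp_norm.
Qed.

Fact linf_prism_bdd (f : linf ('I_m.+1 -> X) V) :
  prism f \in @bddfun R ('I_m -> X * X) V.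
Proof. by apply/asboolP; exists (m%:R * `|f|); exact: prism_norm. Qed.

Definition linf_prism f : linf ('I_m -> X * X) V := Linf (linf_prism_bdd f).

Fact linf_prism_linear : linear linf_prism.
Proof. by move=> a f g; apply: val_inj; apply/funext => z; exact: prismP. Qed.
HB.instance Definition _ := GRing.isLinear.Build R (linf ('I_m.+1 -> X) V)
  (linf ('I_m -> X * X) V) _ linf_prism linf_prism_linear.

Lemma linf_prism_norm f : `|linf_prism f| <= m%:R * `|f|.
Proof. by apply: linf_le => [|z]; [rewrite mulr_ge0|exact: prism_norm]. Qed.

End LinfPrism.

End Means.

Lemma linf_sumE (R : realType) X (V : normedModType R) I (r : seq I)
    (F : I -> linf X V) x : (\sum_(i <- r) F i) x = \sum_(i <- r) F i x.
Proof. by elim/big_rec2: _ => // i y F' _ <-. Qed.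

(** * Compatibility of averages with coboundaries and contragredient operators *)

Section FiberMeanCochains.
Context {R : realType} {W : normedModType R}.

(** The formula of [linf_d] over any vertex set, since prisms live over pairs of group elements. *)
Definition linf_alt X (V : normedModType R) m (F : linf ('I_m -> X) V) :
    linf ('I_m.+1 -> X) V :=
  \sum_(j < m.+1)
    (-1) ^+ j *: linf_comp (fun (x : 'I_m.+1 -> X) i => x (lift j i)) F.

Lemma linf_altE X (V : normedModType R) m (F : linf ('I_m -> X) V) x :
  linf_alt F x = alt F x.
Proof. by rewrite /linf_alt linf_sumE. Qed.

Definition pointwise Y T Z (phi : Y -> T -> Z) m (y : 'I_m -> Y)
  (t : 'I_m -> T) : 'I_m -> Z := fun i => phi (y i) (t i).

(** The [j]-th face forgets the variable [t j], so [power_mean_face] integrates it out. *)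
Lemma fiber_mean_alt Y T Z (mu : mean (R := R) T) (phi : Y -> T -> Z) m
    (F : linf ('I_m -> Z) (dual W)) :
  fiber_mean (power_mean mu m.+1) (pointwise phi (m := m.+1)) (linf_alt F) =
  linf_alt (fiber_mean (power_mean mu m) (pointwise phi (m := m)) F).
Proof.
rewrite /linf_alt linear_sum; apply: eq_bigr => j _.
rewrite linearZ; congr (_ *: _); apply: val_inj; apply/funext => y.
apply: val_inj; apply/funext => v.
rewrite -[RHS](power_mean_face mu j).
by apply: (congr1 (power_mean mu m.+1)); apply: val_inj.
Qed.

(** An adjoint acts by moving the evaluation point from [v] to [S v], hence passes through a mean
    taken pointwise in [v]. This is how the contragredient action comes out of averages. *)
Lemma weak_mean_dual_comp T (mu : mean (R := R) T) (W' : normedModType R)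
    (S : {linear W -> W'}) (hS : contractive S)
    (F : linf T (dual W')) (F' : linf T (dual W)) :
  (forall t, F' t = dual_comp hS (F t)) ->
  weak_mean mu F' = dual_comp hS (weak_mean mu F).
Proof.
move=> E; apply: val_inj; apply/funext => v; apply: (congr1 mu).
by apply: val_inj; apply/funext => t; rewrite /= E.
Qed.

End FiberMeanCochains.

(** * From levelwise identities to the quotients by infinitesimals *)

Section InducedOperators.
Context {R : realType} (w : freeUltrafilter).
Implicit Types V W X : nat -> normedModType R.

Lemma tclsD V (u v : dseq (fun n => V n)) hu hv : exists h,
  @tcls R w V u hu + @tcls R w V v hv = @tcls R w V (fun n => u n + v n) h.
Proof.
have h : exists M : R, w [set n | `|u n + v n| <= M].
  apply/(bddpartE w (fun n => u n + v n)); rewrite -uvecD.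
  by rewrite rpredD//; exact/bddpartE.
exists h; rewrite /tcls -linearD; congr sqpi; apply: val_inj.
exact: uvecD.
Qed.

Lemma tcls0 V : exists h, @tcls R w V (fun=> 0) h = 0.
Proof.
have h : exists M : R, w [set n | `|0 : V n| <= M].
  by exists 0; apply: filterS filterT => n _ /=; rewrite normr0.
exists h; rewrite -(linear0 (sqpi (@infpart w R V))); congr sqpi.
exact: val_inj.
Qed.

Lemma tmor_eq0 V W (F : bop V W) :
  (forall n v, F n v = 0) -> forall p, tmor w F p = 0.
Proof.
move=> F0 p; have [v [hv ->]] := tcls_surj p.
have [h1 ->] := tmorE F hv; have [h2 <-] := tcls0 W.
by apply: tcls_ae; apply: filterS filterT => n _; exact: F0.
Qed.

Lemma tmor_retract V W (F : bop V W) (G : bop W V) :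
  (forall n v, G n (F n v) = v) -> forall p, tmor w G (tmor w F p) = p.
Proof.
move=> GF p; have [v [hv ->]] := tcls_surj p.
have [h1 ->] := tmorE F hv; have [h2 ->] := tmorE G h1.
by apply: tcls_ae; apply: filterS filterT => n _; exact: GF.
Qed.

(** Commutation is asked only on a set of [w]: the chosen representatives of an element of the
    ultrapower and of its image in the quotient match only there. *)
Lemma tmor_square V W W' X (F : bop V W) (G : bop W X)
    (F' : bop V W') (G' : bop W' X) :
  w [set n | forall v, G n (F n v) = G' n (F' n v)] ->
  forall p, tmor w G (tmor w F p) = tmor w G' (tmor w F' p).
Proof.
move=> E p; have [v [hv ->]] := tcls_surj p.
have [h1 ->] := tmorE F hv; have [h2 ->] := tmorE G h1.
have [h3 ->] := tmorE F' hv; have [h4 ->] := tmorE G' h3.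
by apply: tcls_ae; apply: filterS E => n /= ->.
Qed.

Lemma tmor_homotopy V W W' X (d : bop V W) (h : bop W V) (h' : bop V W')
    (d' : bop W' V) (q : bop V X) (p : bop X V) :
  (forall n v, h n (d n v) + d' n (h' n v) + v = p n (q n v)) ->
  forall x, tmor w h (tmor w d x) + tmor w d' (tmor w h' x) + x =
    tmor w p (tmor w q x).
Proof.
move=> E x; have [v [hv ->]] := tcls_surj x.
have [h1 ->] := tmorE d hv; have [h2 ->] := tmorE h h1.
have [h3 ->] := tmorE h' hv; have [h4 ->] := tmorE d' h3.
have [h5 ->] := tmorE q hv; have [h6 ->] := tmorE p h5.
have [h7 ->] := tclsD h2 h4; have [h8 ->] := tclsD h7 hv.
by apply: tcls_ae; apply: filterS filterT => n _; exact: E.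
Qed.

End InducedOperators.

(** * Averaging over cosets of [N] and the homotopy, at each level *)

Section Descent.
Context {R : realType} (w : freeUltrafilter) {G : groupType}.
Context (N : normalSubgroup G) (mu : mean (R := R) (subgroup N)).
Context (mu_inv : forall g f, mu (linf_comp (fun x => g * x)%g f) = mu f).
Context (V0 : asymSystem (R := R) (quotient_group N)).
Let V := dual_system V0.
Let U := res_system (qproj N) V.

(** The representative [repr q] is an arbitrary choice; [weak_mean_coset] makes it immaterial. *)
Definition descend m n :
    {linear cochain_family U m n -> cochain_family V m n} :=
  fiber_mean (W := as_space V0 n) (power_mean mu m)
    (pointwise (fun q (t : subgroup N) => repr q * subgroup_val t)%g (m := m)).

(** Averages a function of pairs over second entries in the coset of the first; it will be applied
    to prisms. *)
Definition spread m n : {linear linf ('I_m -> G * G) (as_family U n) ->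
    cochain_family U m n} :=
  fiber_mean (W := as_space V0 n) (power_mean mu m)
    (pointwise (fun x (t : subgroup N) => (x, x * subgroup_val t))%g (m := m)).

Definition homotopy m n :
    {linear cochain_family U m.+1 n -> cochain_family U m n} :=
  spread m n \o linf_prism.

(** Replacing [x] by [y] translates the variable [t] by an element of [N] in each coordinate, which
    the invariant mean absorbs. *)
Lemma weak_mean_coset (W : normedModType R) m
    (f : linf ('I_m -> G) (dual W)) (x y : 'I_m -> G) :
  (forall i, ((x i)^-1 * y i)%g \in (N : {pred G})) ->
  weak_mean (power_mean mu m)
    (linf_comp (fun t i => y i * subgroup_val (t i))%g f) =
  weak_mean (power_mean mu m)
    (linf_comp (fun t i => x i * subgroup_val (t i))%g f).
Proof.
move=> xy; apply: val_inj; apply/funext => v /=.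
rewrite -[RHS](power_mean_invariant mu_inv (fun i => Subgroup (xy i))).
apply: (congr1 (power_mean mu m)); apply: val_inj; apply/funext => t /=.
by congr (f _ v); apply/funext => i; rewrite /= !mulgA mulgV mul1g.
Qed.

Lemma pull_descendE m n (f : cochain_family U m n) x :
  linf_pull (qproj N) V m n (descend m n f) x =
  weak_mean (power_mean mu m)
    (linf_comp (fun t i => x i * subgroup_val (t i))%g f).
Proof. by apply: weak_mean_coset => i; exact: repr_qproj. Qed.

(** A function pulled back from the quotient is constant on cosets, so averaging returns its
    value. *)
Lemma descend_pull m n (f : cochain_family V m n) :
  descend m n (linf_pull (qproj N) V m n f) = f.
Proof.
apply: val_inj; apply/funext => q; apply: weak_mean_cst => t /=.
congr (f _); apply/funext => i; rewrite /pointwise -[RHS](reprK (q i)).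
apply/esym/qproj_eq; rewrite mulgA mulVg mul1g; exact: subgroup_valP.
Qed.

Lemma descend_act m n g (f : cochain_family U m n) :
  descend m n (linf_act U m n g f) =
  linf_act V m n (qproj N g) (descend m n f).
Proof.
apply: val_inj; apply/funext => q.
(* Both [g^-1 * repr (q i)] and the chosen representative lie in the translated coset. The action is
   first pulled out of the mean with the former, then the representative is changed. *)
pose h : linf ('I_m -> subgroup N) (dual (as_space V0 n)) :=
  linf_comp (fun t i => g^-1 * repr (q i) * subgroup_val (t i))%g f.
transitivity (as_act V n (qproj N g) (weak_mean (power_mean mu m) h)).
  apply: weak_mean_dual_comp => t /=.
  by congr (dual_comp _ (f _)); apply/funext => i; rewrite mulgA.
congr (as_act V n (qproj N g) _); apply/esym/weak_mean_coset => i.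
have -> : ((qproj N g)^-1 * q i)%g = qproj N (g^-1 * repr (q i))%g.
  by rewrite qprojM gmulfV; congr (_ * _)%g; rewrite /qproj reprK.
exact: repr_qproj.
Qed.

Lemma descend_d m n (f : cochain_family U m n) :
  descend m.+1 n (linf_d f) = linf_d (descend m n f).
Proof. exact: fiber_mean_alt. Qed.

(** Left translation by [g] commutes with right translation by [t], so the naturality of the prism
    suffices. *)
Lemma homotopy_act m n g (f : cochain_family U m.+1 n) :
  homotopy m n (linf_act U m.+1 n g f) = linf_act U m n g (homotopy m n f).
Proof.
apply: val_inj; apply/funext => x; apply: weak_mean_dual_comp => t /=.
rewrite [LHS](prism_linear (as_act V n (qproj N g))); congr (dual_comp _ _).
rewrite [LHS](prism_comp (fun y => g^-1 * y)%g).
congr (prism _ _); apply/funext => i; rewrite /pointwise/=.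
by rewrite mulgA.
Qed.

(** This is [prism_homotopy] under [spread], which commutes with coboundaries: the second projection
    averages to the pullback of the descent, the first to [f]. *)
Lemma homotopyP m n (f : cochain_family U m.+1 n) :
  homotopy m.+1 n (linf_d f) + linf_d (homotopy m n f) + f =
  linf_pull (qproj N) V m.+1 n (descend m.+1 n f).
Proof.
have -> : homotopy m.+1 n (linf_d f) + linf_d (homotopy m n f) =
    spread m.+1 n (linf_comp (fun z i => (z i).2) f -
                   linf_comp (fun z i => (z i).1) f).
  transitivity
    (spread m.+1 n (linf_prism (linf_alt f) + linf_alt (linf_prism f))).
    rewrite linearD; congr (_ + _); exact/esym/fiber_mean_alt.
  apply: (congr1 (spread m.+1 n)); apply: val_inj; apply/funext => z.
  rewrite -[RHS]prism_homotopy -[RHS]/(_ + _) -[LHS]/(_ + _).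
  congr (_ + _); last exact: linf_altE.
  by congr (prism _ z); apply/funext => x; exact: linf_altE.
(* The first entry does not depend on [t], so a constant is averaged. *)
have fst_f : spread m.+1 n (linf_comp (fun z i => (z i).1) f) = f.
  by apply: val_inj; apply/funext => x; exact: weak_mean_cst.
rewrite linearB fst_f subrK.
apply: val_inj; apply/funext => x; rewrite [RHS]pull_descendE.
by apply: (congr1 (weak_mean _)); apply: val_inj.
Qed.

(** A prism over the empty tuple is an empty sum. Degree 0 needs this, as its only coboundary is
    zero. *)
Lemma homotopy0 n (f : cochain_family U 1 n) : homotopy 0 n f = 0.
Proof.
by apply: val_inj; apply/funext => x; apply: weak_mean_cst.
Qed.


(** * The averaging map and the homotopy on asymptotic cochains *)

Fact descend_bound m :
  exists C : R, forall n f, `|descend m n f| <= C * `|f|.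
Proof. by exists 1 => n f; rewrite mul1r; exact: fiber_mean_norm. Qed.

Fact homotopy_bound m :
  exists C : R, forall n f, `|homotopy m n f| <= C * `|f|.
Proof.
exists m%:R => n f.
exact: le_trans (fiber_mean_norm _ _ _) (linf_prism_norm _).
Qed.

Definition descend_bop m :
    bop (cochain_family U m) (cochain_family V m) := Bop (descend_bound m).

Definition homotopy_bop m :
    bop (cochain_family U m.+1) (cochain_family U m) := Bop (homotopy_bound m).

Definition cochain_descend m : {linear cochain w U m -> cochain w V m} :=
  tmor w (descend_bop m).

Definition cochain_homotopy m :
    {linear cochain w U m.+1 -> cochain w U m} := tmor w (homotopy_bop m).

Lemma cochain_descend_pull m x :
  cochain_descend m (cochain_pull w (qproj N) V m x) = x.
Proof.
apply: (tmor_retract (F := linf_pull_bop (qproj N) V m) (G := descend_bop m)).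
by move=> n; exact: descend_pull.
Qed.

Lemma cochain_descend_d m x :
  cochain_descend m.+1 (cochain_d w U m x) =
  cochain_d w V m (cochain_descend m x).
Proof.
apply: (tmor_square (F := linf_d_bop U m) (G := descend_bop m.+1)
  (F' := descend_bop m) (G' := linf_d_bop V m)).
by apply: filterS filterT => n _ v; exact: descend_d.
Qed.

Lemma cochain_descend_act m (g : upow w G) x :
  cochain_descend m (cochain_act U m g x) =
  cochain_act V m (umap (fun=> qproj N) g : upow w (quotient_group N))
    (cochain_descend m x).
Proof.
apply: (tmor_square (F := linf_act_bop U m (repr g)) (G := descend_bop m)
  (F' := descend_bop m) (G' := linf_act_bop V m _)).
apply: filterS (repr_ucls w (fun n => qproj N (repr g n))) => n /= -> v.
exact: descend_act.
Qed.

Lemma cochain_homotopy_act m (g : upow w G) x :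
  cochain_homotopy m (cochain_act U m.+1 g x) =
  cochain_act U m g (cochain_homotopy m x).
Proof.
apply: (tmor_square (F := linf_act_bop U m.+1 (repr g)) (G := homotopy_bop m)
  (F' := homotopy_bop m) (G' := linf_act_bop U m (repr g))).
by apply: filterS filterT => n _ v; exact: homotopy_act.
Qed.

Lemma cochain_homotopyP m x :
  cochain_homotopy m.+1 (cochain_d w U m.+1 x) +
    cochain_d w U m (cochain_homotopy m x) + x =
  cochain_pull w (qproj N) V m.+1 (cochain_descend m.+1 x).
Proof.
apply: (tmor_homotopy (d := linf_d_bop U m.+1) (h := homotopy_bop m.+1)
  (h' := homotopy_bop m) (d' := linf_d_bop U m) (q := descend_bop m.+1)
  (p := linf_pull_bop (qproj N) V m.+1)).
by move=> n; exact: homotopyP.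
Qed.

Lemma cochain_homotopy0 x : cochain_homotopy 0 x = 0.
Proof.
by apply: (tmor_eq0 (F := homotopy_bop 0)) => n v; exact: homotopy0.
Qed.

(** * Invariants, cocycles and the inverse in cohomology *)

Lemma invariants_descend m x :
  x \in @invariants R w G U m -> cochain_descend m x \in @invariants R w _ V m.
Proof.
move=> /asboolP hx; apply/asboolP => q; have [{}q ->] := ucls_surj q.
(* Every element of the ultrapower of the quotient lifts levelwise to the ultrapower of [G]. *)
pose g : upow w G := ucls w (fun n => repr (q n)).
have -> : ucls w q = umap (fun=> qproj N) g.
  rewrite umapE; congr ucls; apply: functional_extensionality_dep => n.
  by rewrite /qproj reprK.
exact: etrans (esym (cochain_descend_act g x))
  (congr1 (cochain_descend m) (hx g)).
Qed.

Lemma invariants_homotopy m x :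
  x \in @invariants R w G U m.+1 ->
  cochain_homotopy m x \in @invariants R w G U m.
Proof.
move=> /asboolP hx; apply/asboolP => g.
exact: etrans (esym (cochain_homotopy_act _ _)) (congr1 _ (hx _)).
Qed.

Lemma cocycle_descend n x : x \in @cocycle R w G U n ->
  cochain_descend n.+1 x \in @cocycle R w _ V n.
Proof.
move=> /asboolP[hx dx]; apply/asboolP; split; first exact: invariants_descend.
exact: etrans (esym (cochain_descend_d _)) (etrans (congr1 _ dx) (linear0 _)).
Qed.

Lemma coboundary_descend n x : x \in @coboundary R w G U n ->
  cochain_descend n.+1 x \in @coboundary R w _ V n.
Proof.
case: n x => [|n] x /asboolP.
  by move=> ->; apply/asboolP; rewrite linear0.
move=> [y hy <-]; apply/asboolP; exists (cochain_descend n.+1 y).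
  exact: invariants_descend.
exact/esym/cochain_descend_d.
Qed.

(** On a cocycle the homotopy formula leaves only the coboundary of [cochain_homotopy], whose
    argument is invariant, or zero in degree 0. *)
Lemma coboundary_pull_descend n x : x \in @cocycle R w G U n ->
  cochain_pull w (qproj N) V n.+1 (cochain_descend n.+1 x) - x
    \in @coboundary R w G U n.
Proof.
move=> /asboolP[hx dx]; rewrite -cochain_homotopyP dx linear0 add0r addrK.
case: n x hx dx => [|n] x hx dx; apply/asboolP.
  by rewrite cochain_homotopy0 linear0.
by exists (cochain_homotopy n.+1 x) => //; exact: invariants_homotopy.
Qed.

(** The inverse is induced by [cochain_descend]: one composite is the identity already on cochains,
    the other only modulo coboundaries. *)
Lemma pullback_bijective n : bijective (pullback w (qproj N) V n).
Proof.
pose A := sqmap (@cocycle_descend n) (fun x _ => @coboundary_descend n x).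
exists A => c; have [x ->] := sqpi_surj c.
  rewrite [pullback _ _ _ _ _]sqmapE [A _]sqmapE; congr sqpi.
  by apply: val_inj; exact: cochain_descend_pull.
rewrite [A _]sqmapE [pullback _ _ _ _ _]sqmapE; apply/sqpi_eq.
exact/coboundary_pull_descend/subm_valP.
Qed.

End Descent.

(** * Pullback modulo an amenable normal subgroup *)

Theorem proposition1p9 (R : realType) (w : freeUltrafilter)
    (Gamma : groupType) (N : normalSubgroup Gamma)
    (Gamma_countable : countable [set: Gamma])
    (N_amenable : amenable R (subgroup N))
    (n : nat) (V : asymSystem (R := R) (quotient_group N)) :
  dual_asym_banach_module w V -> bijective (pullback w (qproj N) V n).
Proof.
move=> [V0 _ ->]; have [m [m0 m1 m_inv]] := N_amenable.
(* Amenability enters here: the invariant positive functional is repackaged as a contractive mean,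
   and its invariance carries over. *)
have [mu muE] := positive_mean m0 m1.
have mu_inv g f : mu (linf_comp (fun x => g * x)%g f) = mu f.
  by rewrite !muE m_inv.
exact: (pullback_bijective w mu_inv V0 n).
Qed.
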